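(* Let $\Omega\subset\mathbb{R}^n$ be open and bounded, let $s\in(0,1)$, and let $G$ be a Young function such that $1<p^-\le \frac{t g(t)}{G(t)}\le p^+<\infty$ for all $t>0$ and $p^->\frac{n}{s(1-s)}$. Let $\mu>0$, and let $u_{1,\mu}$ be an eigenfunction of $\lambda_{1,\mu}$. Then $u_{1,\mu}$ has constant sign in $\Omega$, i.e. either $u_{1,\mu}>0$ in $\Omega$ or $u_{1,\mu}<0$ in $\Omega$.
   Context: A Young function is a function $G:[0,\infty)\to[0,\infty)$ of the form $G(t)=\int_0^t g(\tau)\,d\tau$, where $g:[0,\infty)\to[0,\infty)$ is right continuous and nondecreasing, $g(0)=0$, $g(t)>0$ for $t>0$, and $\lim_{t\to\infty}g(t)=\infty$. Put $D_su(x,y)=\frac{u(x)-u(y)}{|x-y|^s}$. For an open set $U\subseteq\mathbb{R}^n$, $W^{s,G}(U)$ is the set of measurable $u:\mathbb{R}^n\to\mathbb{R}$ with $\int_U G(|u|)\,dx<\infty$ and $\iint_{\mathbb{R}^n\times\mathbb{R}^n}G(|D_su|)\frac{dx\,dy}{|x-y|^n}<\infty$, and $W^{s,G}_0(\Omega)=\{u\in W^{s,G}(\mathbb{R}^n):u=0\text{ a.e. in }\mathbb{R}^n\setminus\Omega\}$. Let $$\mathcal{F}(u)=\iint_{\mathbb{R}^n\times\mathbb{R}^n}G(|D_su|)\frac{dx\,dy}{|x-y|^n},\quad \mathcal{G}(u)=\int_\Omega G(|u|)\,dx,\quad M_\mu=\{u\in W^{s,G}_0(\Omega):\mathcal{G}(u)=\mu\}.$$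 Here $u_{1,\mu}\in M_\mu$ denotes a function attaining the infimum $\alpha_{1,\mu}=\inf_{u\in M_\mu}\mathcal{F}(u)/\mathcal{G}(u)$, and $\lambda_{1,\mu}\in\mathbb{R}$ is the associated eigenvalue (Lagrange multiplier): $$\iint_{\mathbb{R}^n\times\mathbb{R}^n}g(|D_su_{1,\mu}|)\frac{D_su_{1,\mu}}{|D_su_{1,\mu}|}D_sv\,\frac{dx\,dy}{|x-y|^n}=\lambda_{1,\mu}\int_\Omega g(|u_{1,\mu}|)\frac{u_{1,\mu}}{|u_{1,\mu}|}v\,dx\quad\text{for all }v\in W^{s,G}_0(\Omega).$$ Expressions $g(|a|)\frac{a}{|a|}$ are understood as $0$ when $a=0$. Under the assumption $p^->\frac{n}{s(1-s)}$ (in particular $sp^->n$) elements of $W^{s,G}_0(\Omega)$ are continuous, and are identified with their continuous representative. *)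

(* Defs.v *)
From HB Require Import structures.
From mathcomp Require Import all_boot all_order all_algebra.
From mathcomp Require Import all_classical all_reals all_analysis.

Set Implicit Arguments.
Unset Strict Implicit.
Unset Printing Implicit Defensive.

Import Order.TTheory GRing.Theory Num.Theory.
Import numFieldNormedType.Exports.

Local Open Scope classical_set_scope.
Local Open Scope ring_scope.

(* R^n is 'rV[R]_n.  Its topology is the library's; its measurable sets are
   those generated by the coordinates, i.e. the product sigma-algebra, which is
   the Borel one (same construction as the library's n.-tuple R).  Every Lebesgue
   measurable function is a.e. equal to a Borel one, so working with Borel
   functions changes neither the integrals nor the infimum below. *)
Fact rV_display : measure_display -> measure_display. Proof. by []. Qed.

Section measurable_rV.
Context (R : realType) (n : nat).

Definition rV_coord (i : 'I_n) (x : 'rV[R]_n) : R := x ord0 i.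

Let rV_set0 : g_sigma_preimage rV_coord set0.
Proof. exact: sigma_algebra0. Qed.

Let rV_setC A : g_sigma_preimage rV_coord A -> g_sigma_preimage rV_coord (~` A).
Proof. exact: sigma_algebraC. Qed.

Let rV_bigcup (F : _^nat) : (forall i, g_sigma_preimage rV_coord (F i)) ->
  g_sigma_preimage rV_coord (\bigcup_i (F i)).
Proof. exact: sigma_algebra_bigcup. Qed.

HB.instance Definition _ := @isMeasurable.Build (rV_display default_measure_display)
  'rV[R]_n (g_sigma_preimage rV_coord) rV_set0 rV_setC rV_bigcup.

End measurable_rV.

Lemma measurable_rV_coord (R : realType) n (i : 'I_n) :
  measurable_fun [set: 'rV[R]_n] (rV_coord i).
Proof.
move=> _ Y mY; rewrite setTI; apply: sub_sigma_algebra => /=.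
rewrite -bigcup_seq/=; exists i => /=; first by rewrite mem_index_enum.
by exists Y => //; rewrite setTI.
Qed.

Lemma measurable_fun_rVP d (T : measurableType d) (R : realType) n
    (f : T -> 'rV[R]_n) :
  (forall i, measurable_fun [set: T] (fun t => f t ord0 i)) ->
  measurable_fun [set: T] f.
Proof.
move=> mf _ A mA; rewrite setTI.
suff : (measurable : set (set 'rV[R]_n)) `<=` [set B | measurable (f @^-1` B)].
  exact.
apply: smallest_sub.
- split => [|B mB|F mF] /=; first by rewrite preimage_set0.
  + by rewrite setTD preimage_setC; exact: measurableC.
  + by rewrite preimage_bigcup; exact: bigcupT_measurable.
- move=> B; rewrite -bigcup_seq => -[i _ [C mC <-]] /=.
  by rewrite setTI -comp_preimage -[X in measurable X]setTI; exact: mf.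
Qed.

Section lebesgue_step.
Context (R : realType) (n : nat).

Definition cons_rV (p : R * 'rV[R]_n) : 'rV[R]_n.+1 :=
  row_mx (const_mx p.1 : 'rV_1) p.2.

Lemma cons_rV0 p : cons_rV p ord0 ord0 = p.1.
Proof.
transitivity (cons_rV p ord0 (lshift n (ord0 : 'I_1))).
  by congr (cons_rV p _ _); exact: ord_inj.
by apply: etrans (row_mxEl _ _ _ _) _; rewrite mxE.
Qed.

Lemma cons_rVS p i : cons_rV p ord0 (lift ord0 i) = p.2 ord0 i.
Proof.
transitivity (cons_rV p ord0 (rshift 1 i)).
  by congr (cons_rV p _ _); exact: ord_inj.
exact: row_mxEr.
Qed.

Lemma measurable_cons_rV : measurable_fun [set: R * 'rV[R]_n] cons_rV.
Proof.
apply: measurable_fun_rVP => i; case: (unliftP ord0 i) => [j ->|->].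
- rewrite (_ : (fun _ => _) = @rV_coord R n j \o snd); last first.
    by apply/funext => p /=; rewrite cons_rVS.
  by apply: measurableT_comp => //; exact: measurable_rV_coord.
- rewrite (_ : (fun _ => _) = fst)//.
  by apply/funext => p /=; rewrite cons_rV0.
Qed.

Variable m : {sigma_finite_measure set 'rV[R]_n -> \bar R}.

Definition lebesgue_step : set 'rV[R]_n.+1 -> \bar R :=
  pushforward (@lebesgue_measure R \x m)%E cons_rV.


Let lebesgue_step0 : lebesgue_step set0 = 0%E.
Proof. by rewrite /lebesgue_step /pushforward preimage_set0 measure0. Qed.

Let lebesgue_step_ge0 A : (0 <= lebesgue_step A)%E.
Proof. by rewrite /lebesgue_step /pushforward measure_ge0. Qed.

Let lebesgue_step_sigma_additive : semi_sigma_additive lebesgue_step.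
Proof.
move=> F mF tF mUF; rewrite /lebesgue_step /pushforward preimage_bigcup.
apply: measure_semi_sigma_additive.
- by move=> k; rewrite -[X in measurable X]setTI; exact: measurable_cons_rV.
- apply/trivIsetP => /= i j _ _ ij; rewrite -preimage_setI.
  by move/trivIsetP : tF => /(_ _ _ _ _ ij) ->//; rewrite preimage_set0.
- rewrite -preimage_bigcup -[X in measurable X]setTI.
  exact: measurable_cons_rV.
Qed.

HB.instance Definition _ := isMeasure.Build _ _ _ lebesgue_step
  lebesgue_step0 lebesgue_step_ge0 lebesgue_step_sigma_additive.

Let lebesgue_step_sigma_finite : sigma_finite setT lebesgue_step.
Proof.
(* The product of sigma-finite measures is not canonically sigma-finite. *)
have [F UF Fley] : sigma_finite setT (@lebesgue_measure R \x m)%E.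
  have /sigma_finiteP[F [TF ndF Foo]] := sigma_finiteT (@lebesgue_measure R).
  have /sigma_finiteP[H [TH ndH Hoo]] := sigma_finiteT m.
  exists (fun k => F k `*` H k).
    rewrite -setXTT TF TH predeqE => -[x y]; split.
      move=> [/= [i _ Fix] [k _ Hky]]; exists (maxn i k) => //; split.
      - by move: x Fix; exact/subsetPset/ndF/leq_maxl.
      - by move: y Hky; exact/subsetPset/ndH/leq_maxr.
    by move=> [k _ []/= ? ?]; split; exists k.
  move=> k; have [? ?] := Foo k; have [? ?] := Hoo k.
  split; first exact: measurableX.
  by rewrite product_measure1E// lte_mul_pinfty// ge0_fin_numE.
pose ucons (x : 'rV[R]_n.+1) : R * 'rV[R]_n :=
  (x ord0 ord0, \row_i x ord0 (lift ord0 i)).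
have uconsK : cancel cons_rV ucons.
  move=> [a v]; rewrite /ucons cons_rV0; congr (_, _).
  by apply/rowP => i; rewrite mxE cons_rVS.
have mucons : measurable_fun [set: 'rV[R]_n.+1] ucons.
  apply: measurable_fun_pair; first exact: measurable_rV_coord.
  apply: measurable_fun_rVP => i; under eq_fun do rewrite mxE.
  exact: measurable_rV_coord.
exists (fun k => ucons @^-1` F k).
  by rewrite -preimage_bigcup -UF preimage_setT.
move=> k; have [mFk Fkley] := Fley k; split.
  by rewrite -[X in measurable X]setTI; exact: mucons.
rewrite /lebesgue_step /pushforward (_ : _ @^-1` _ = F k)//.
by apply/seteqP; split=> p /=; rewrite uconsK.
Qed.

HB.instance Definition _ := Measure_isSigmaFinite.Build _ _ _ lebesgue_step
  lebesgue_step_sigma_finite.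

End lebesgue_step.

Fixpoint lebesgue_rV (R : realType) (n : nat) :
    {sigma_finite_measure set 'rV[R]_n -> \bar R} :=
  match n with
  | 0 => @dirac _ 'rV[R]_0 0 R
  | n'.+1 => lebesgue_step (lebesgue_rV R n')
  end.

(* Sanity check: lebesgue_rV gives boxes the product of their side measures. *)
Lemma lebesgue_rV_box (R : realType) (n : nat) (A : 'I_n -> set R) :
  (forall i, measurable (A i)) ->
  lebesgue_rV R n [set x | forall i, A i (x ord0 i)] =
  (\prod_(i < n) @lebesgue_measure R (A i))%E.
Proof.
elim: n A => [|n IH] A mA.
  by rewrite big_ord0 /= diracE mem_set//= => -[].
rewrite big_ord_recl /= /lebesgue_step /pushforward.
rewrite -(IH (fun i => A (lift ord0 i)))//.
have mB : measurable
    [set x : 'rV[R]_n | forall i, A (lift ord0 i) (x ord0 i)].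
  rewrite (_ : mkset _ =
      \big[setI/setT]_(i < n) (rV_coord i @^-1` A (lift ord0 i))).
    apply: bigsetI_measurable => i _; rewrite -[X in measurable X]setTI.
    exact: measurable_rV_coord.
  rewrite -bigcap_seq; apply/seteqP; split=> x /= h; first by move=> i _; exact: h.
  by move=> i; apply: h; rewrite /= mem_index_enum.
rewrite -product_measure1E//; last exact: mA.
congr (_ _); apply/seteqP; split=> p /=.
  by move=> h; split=> [|i]; [rewrite -cons_rV0|rewrite -cons_rVS]; exact: h.
move=> [h0 h] i; case: (unliftP ord0 i) => [j ->|->].
  by rewrite cons_rVS; exact: h.
by rewrite cons_rV0.
Qed.

Section fractional_orlicz_sobolev.
Context (R : realType).
Implicit Types (n : nat) (g G : R -> R) (s : R).

(* g and G are only constrained on [0, +oo[; their values elsewhere are never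
   used. *)
Definition young_function g G : Prop :=
  [/\ forall t, 0 <= t -> g x @[x --> t^'+] --> g t,
      forall t t', 0 <= t -> t <= t' -> g t <= g t',
      g 0 = 0 /\ (forall t, 0 < t -> 0 < g t),
      g t @[t --> +oo] --> +oo &
      forall t, 0 <= t ->
        G t = (\int[@lebesgue_measure R]_(tau in `[0%R, t]) g tau)%R].

(* The norm of the normed module 'rV[R]_n is the sup norm. *)
Definition euclidean_norm n (x : 'rV[R]_n) : R :=
  Num.sqrt (\sum_(i < n) x ord0 i ^+ 2).

(* On the diagonal division by 0 gives 0; for n > 0 the diagonal is negligible. *)
Definition Dquot s n (u : 'rV[R]_n -> R) (z : 'rV[R]_n * 'rV[R]_n) : R :=
  (u z.1 - u z.2) / euclidean_norm (z.1 - z.2) `^ s.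

(* \iint h(x, y) dx dy / |x - y|^n over R^n x R^n. *)
Definition iint_nu n (h : 'rV[R]_n * 'rV[R]_n -> R) : \bar R :=
  (\int[lebesgue_rV R n \x lebesgue_rV R n]_z
     (h z / euclidean_norm (z.1 - z.2) ^+ n)%:E)%E.

Definition calF s G n (u : 'rV[R]_n -> R) : \bar R :=
  iint_nu (fun z => G `|Dquot s u z|).

Definition calG G n (U : set 'rV[R]_n) (u : 'rV[R]_n -> R) : \bar R :=
  (\int[lebesgue_rV R n]_(x in U) (G `|u x|)%:E)%E.

Definition WsG s G n (U : set 'rV[R]_n) : set ('rV[R]_n -> R) :=
  [set u | [/\ measurable_fun setT u,
               (calG G U u < +oo)%E & (calF s G u < +oo)%E]].

Definition WsG0 s G n (Omega : set 'rV[R]_n) : set ('rV[R]_n -> R) :=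
  [set u | WsG s G setT u /\
           {ae lebesgue_rV R n, forall x, ~ Omega x -> u x = 0}].

Definition Mmu s G n (Omega : set 'rV[R]_n) (mu : R) : set ('rV[R]_n -> R) :=
  [set u | WsG0 s G Omega u /\ calG G Omega u = mu%:E].

Definition alpha1 s G n (Omega : set 'rV[R]_n) (mu : R) : \bar R :=
  ereal_inf [set (calF s G u / calG G Omega u)%E | u in Mmu s G Omega mu].

Definition is_minimizer s G n (Omega : set 'rV[R]_n) (mu : R)
    (u : 'rV[R]_n -> R) : Prop :=
  Mmu s G Omega mu u /\
  (calF s G u / calG G Omega u)%E = alpha1 s G Omega mu.

(* As 0 / 0 = 0, the value at a = 0 is 0. *)
Definition signed_density g (a : R) : R := g `|a| * (a / `|a|).

Definition eigen_equation s g G n (Omega : set 'rV[R]_n) (lambda : R)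
    (u : 'rV[R]_n -> R) : Prop :=
  forall v, WsG0 s G Omega v ->
    iint_nu (fun z => signed_density g (Dquot s u z) * Dquot s v z) =
    (lambda%:E *
      \int[lebesgue_rV R n]_(x in Omega) (signed_density g (u x) * v x)%:E)%E.

End fractional_orlicz_sobolev.

(* Main.v *)
Require Import Defs.
From mathcomp Require Import all_boot all_order all_algebra.
From mathcomp Require Import all_classical all_reals all_analysis.
From mathcomp Require Import measurable_realfun ring lra.

(* Since ||a| - |b|| <= |a - b|, strictly when a < 0 < b, passing from u to |u|
   preserves the constraint and strictly lowers the energy if u changes sign; so
   a minimizer has a sign, say u >= 0, and testing the equation with u gives
   lambda >= 0.  Suppose u(x0) = 0 with x0 in Omega, and test the equation with
   v = (eps phi - u)^+ / 2, where phi is a Lipschitz bump at x0.  The left-hand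
   side must be nonnegative.  Monotonicity of g bounds the positive part of its
   integrand by g applied to the difference quotients of eps phi: as phi is
   Lipschitz and 1 / (1 - s) < p < p^- for some p, this is O(eps^(p-1)) times an
   integrable kernel in x - y, contributing O(eps^(p-1)) int v.  Meanwhile the
   interaction of {v > 0} with a box where u is bounded below contributes at
   most - kappa int v, with kappa independent of eps: a contradiction for small
   eps. *)

Import Order.TTheory GRing.Theory Num.Theory.
Import numFieldNormedType.Exports.

Local Open Scope classical_set_scope.
Local Open Scope ring_scope.

Lemma powR_expr (R : realType) (a c : R) k : 0 <= a ->
  (a `^ c) ^+ k = (a ^+ k) `^ c.
Proof.
move=> a0; elim: k => [|k IH]; first by rewrite !expr0 powR1.
by rewrite !exprS IH powRM// exprn_ge0.
Qed.

(** * Young functions *)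

Section Young.
Context {R : realType} {g G : R -> R}.
Hypothesis young : young_function g G.

Let g_homo (t t' : R) : 0 <= t -> t <= t' -> g t <= g t'.
Proof. by case: young => _ h _ _ _; exact: h. Qed.

Let g00 : g 0 = 0.
Proof. by case: young => _ _ []. Qed.

Let g_gt0 (t : R) : 0 < t -> 0 < g t.
Proof. by case: young => _ _ [] _ h _ _; exact: h. Qed.

Let GE (t : R) : 0 <= t ->
  G t = (\int[@lebesgue_measure R]_(tau in `[0%R, t]) g tau)%R.
Proof. by case: young => _ _ _ _; apply. Qed.

Lemma young_density_ge0 (t : R) : 0 <= t -> 0 <= g t.
Proof. by move=> t0; rewrite -g00; exact: g_homo. Qed.

(** The increment is the integral of the nondecreasing [g] over []t, t']]. Monotonicity and the
    power bound for [G] are drawn from this estimate. *)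
Lemma young_increment (t t' : R) : 0 <= t -> t <= t' ->
  (t' - t) * g t <= G t' - G t <= (t' - t) * g t'.
Proof.
move=> t0; rewrite le_eqVlt => /predU1P[<-|tt']; first by rewrite !subrr !mul0r lexx.
have t'0 : 0 <= t' by rewrite (le_trans t0)// ltW.
have mg : measurable_fun `[0, t'] g.
  (* [g] is monotone on [[0, +oo[] only; precomposing with the positive part makes it monotone on
     the whole line. *)
  refine (eq_measurable_fun (fun x : R => g (Num.max x 0)) _ _).
    move=> x; rewrite inE/= in_itv/= => /andP[x0 _].
    by rewrite max_l.
  apply: nondecreasing_measurable => // x y xy.
  apply: g_homo; first by rewrite le_max lexx orbT.
  by rewrite ge_max !le_max xy lexx orbT.
have ig : (@lebesgue_measure R).-integrable `[0, t'] (EFin \o g).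
  apply: measurable_bounded_integrable => //.
    apply: (@le_lt_trans _ _ (@lebesgue_measure R `[0, t'])) => //.
    by rewrite lebesgue_measure_itv/=; case: ifP => // _; rewrite -EFinD ltry.
  exists (g t'); split; first exact: num_real.
  move=> M gM x /=; rewrite in_itv/= => /andP[x0 xt'].
  by rewrite ger0_norm ?young_density_ge0// (le_trans _ (ltW gM))// g_homo.
have ig2 : (@lebesgue_measure R).-integrable `]t, t'] (EFin \o g).
  apply: integrableS ig => //; apply: subset_itv => //.
have mes : @lebesgue_measure R `]t, t'] = (t' - t)%:E.
  by rewrite lebesgue_measure_itv/= lte_fin tt'.
have icst k : (@lebesgue_measure R).-integrable `]t, t'] (EFin \o cst (k : R)).
  apply: measurable_bounded_integrable => //.
    by apply: (@le_lt_trans _ _ (@lebesgue_measure R `]t, t'])) => //; rewrite mes ltry.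
  by exists `|k|; split; [exact: num_real|move=> M kM x _ /=; exact: ltW].
have cstE (k : R) : (\int[@lebesgue_measure R]_(tau in `]t, t']) (cst k) tau)%R =
    (t' - t) * k.
  transitivity (k * fine (@lebesgue_measure R `]t, t'])); first exact: Rintegral_cst.
  by rewrite mes/= mulrC.
rewrite !GE// Rintegral_itvB//; last by rewrite bnd_simp ltW.
apply/andP; split; rewrite -cstE; apply: le_Rintegral => // x;
  rewrite /= in_itv/= => /andP[tx xt'].
  by apply: g_homo => //; exact: ltW.
by apply: g_homo => //; rewrite (le_trans t0)// ltW.
Qed.

Lemma young0 : G 0 = 0.
Proof. by rewrite GE// set_itv1 Rintegral_set1. Qed.

Lemma young_homo (t t' : R) : 0 <= t -> t <= t' -> G t <= G t'.
Proof.
move=> t0 tt'; have /andP[+ _] := young_increment t t' t0 tt'.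
by rewrite -[G t <= _]subr_ge0; apply: le_trans; rewrite mulr_ge0 ?subr_ge0// young_density_ge0.
Qed.

Lemma young_ge0 (t : R) : 0 <= t -> 0 <= G t.
Proof. by move=> t0; rewrite -young0 young_homo. Qed.

Lemma young_strict_homo (t t' : R) : 0 <= t -> t < t' -> G t < G t'.
Proof.
(* The increment is estimated from the midpoint, where [g > 0] even if [t = 0]. *)
move=> t0 tt'; pose m := (t + t') / 2.
have tm : t < m by rewrite /m; lra.
have mt' : m < t' by rewrite /m; lra.
have m0 : 0 < m by lra.
have /andP[h _] := young_increment m t' (ltW m0) (ltW mt').
apply: (le_lt_trans (young_homo t m t0 (ltW tm))).
by rewrite -subr_gt0 (lt_le_trans _ h)// mulr_gt0 ?subr_gt0// g_gt0.
Qed.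

Lemma young_gt0 (t : R) : 0 < t -> 0 < G t.
Proof. by move=> t0; rewrite -young0 young_strict_homo. Qed.

(** A mean is at most the larger of its two terms. This splits the energy density of the truncation
    into those of [u] and of the tent. *)
Lemma young_half_le (a b c : R) : 0 <= a -> 0 <= b -> 0 <= c -> c <= (a + b) / 2 ->
  G c <= G a + G b.
Proof.
move=> a0 b0 c0 cab; have [ab|/ltW ba] := leP a b.
  apply: (@le_trans _ _ (G b)); first by apply: young_homo => //; lra.
  by rewrite lerDr young_ge0.
apply: (@le_trans _ _ (G a)); first by apply: young_homo => //; lra.
by rewrite lerDl young_ge0.
Qed.

Lemma measurable_young_norm : measurable_fun [set: R] (fun a => G `|a|).
Proof.
rewrite (_ : (fun _ => _) = (fun x => G (Num.max x 0)) \o (fun a => `|a|)); last first.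
  by apply/funext => a /=; rewrite max_l.
apply: measurableT_comp; last exact: normr_measurable.
apply: nondecreasing_measurable => // x y xy.
apply: young_homo; first by rewrite le_max lexx orbT.
by rewrite ge_max !le_max xy lexx orbT.
Qed.

Lemma signed_density_pos (a : R) : 0 < a -> signed_density g a = g a.
Proof. by move=> a0; rewrite /signed_density gtr0_norm// divff ?mulr1// gt_eqF. Qed.

Lemma signed_densityN (a : R) : signed_density g (- a) = - signed_density g a.
Proof. by rewrite /signed_density normrN mulNr mulrN. Qed.

Lemma signed_density0 : signed_density g 0 = 0.
Proof. by rewrite /signed_density mul0r mulr0. Qed.

Lemma signed_density_ge0 (a : R) : 0 <= a -> 0 <= signed_density g a.
Proof.
rewrite le_eqVlt => /predU1P[<-|a0]; first by rewrite signed_density0.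
by rewrite signed_density_pos// ltW// g_gt0.
Qed.

Lemma signed_density_le0 (a : R) : a <= 0 -> signed_density g a <= 0.
Proof.
by move=> a0; rewrite -[a]opprK signed_densityN oppr_le0 signed_density_ge0// oppr_ge0.
Qed.

Lemma signed_density_le (a b : R) : a <= b -> 0 <= b -> signed_density g a <= g b.
Proof.
move=> ab b0; have [a0|a0] := leP a 0.
  by rewrite (le_trans (signed_density_le0 _ a0))// young_density_ge0.
by rewrite signed_density_pos// g_homo// ltW.
Qed.

Lemma signed_density_homo (a b : R) : a <= b -> signed_density g a <= signed_density g b.
Proof.
move=> ab; have [b0|b0] := leP b 0.
  rewrite -[a]opprK -[b]opprK !(signed_densityN (- _)) lerN2.
  have [->|bn0] := eqVneq b 0.
    by rewrite oppr0 signed_density0 signed_density_ge0//; lra.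
  rewrite (signed_density_pos (- a)).
    by apply: signed_density_le; lra.
  have : b < 0 by rewrite lt_neqAle bn0.
  by lra.
by rewrite (signed_density_pos b)// signed_density_le// ltW.
Qed.

Lemma measurable_signed_density : measurable_fun [set: R] (signed_density g).
Proof. by apply: nondecreasing_measurable => // x y; exact: signed_density_homo. Qed.

Lemma signed_density_mul_gt0 (a : R) : a != 0 -> 0 < signed_density g a * a.
Proof.
move=> a0; rewrite /signed_density -mulrA mulr_gt0 ?g_gt0 ?normr_gt0//.
by rewrite mulrAC -expr2 divr_gt0 ?normr_gt0// exprn_even_gt0.
Qed.

(* [G] need not be differentiable, so instead of integrating G'/G >= pm/t one
   iterates [q^p G(t) <= (1 + pm (q - 1)) G(t) <= G(q t)] for a [q > 1] close to 1. *)
Lemma young_power_bound (pm p : R) : 0 < p -> p < pm ->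
  (forall t : R, 0 < t -> pm <= t * g t / G t) ->
  exists2 C : R, 0 < C & forall a : R, 0 < a <= 1 -> G a <= C * a `^ p.
Proof.
move=> p0 ppm hpm.
(* This [h] satisfies [1 + pm * h = pm / p] and [1 - p * h = p / pm], so that [q^p <= exp(p h) <= 1
   / (1 - p h) = 1 + pm h]. *)
pose h := (pm - p) / (p * pm); pose q := 1 + h.
have pm0 : 0 < pm by lra.
have h0 : 0 < h by rewrite /h divr_gt0 ?subr_gt0 ?mulr_gt0.
have q1 : 1 < q by rewrite /q; lra.
have q0 : 0 < q by lra.
have G0 (t : R) : 0 < t -> 0 < G t by exact: young_gt0.
have step (t : R) : 0 < t -> q `^ p * G t <= G (q * t).
  move=> t0; have tqt : t <= q * t by rewrite ler_peMl ?ltW.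
  have /andP[+ _] := young_increment t (q * t) (ltW t0) tqt.
  have -> : q * t - t = h * t by rewrite /q; ring.
  have := hpm _ t0; rewrite ler_pdivlMr ?G0// => hg.
  have qp : q `^ p <= 1 + pm * h.
    apply: (@le_trans _ _ (expR (p * h))).
      rewrite /powR gt_eqF// ler_expR (ler_wpM2l (ltW p0))//.
      by rewrite /q le_ln1Dx//; lra.
    have ph : p * h = 1 - p / pm by rewrite /h; field; rewrite !gt_eqF.
    have pmh : 1 + pm * h = pm / p by rewrite /h; field; rewrite !gt_eqF.
    have -> : expR (p * h) = (expR (- (p * h)))^-1 by rewrite expRN invrK.
    rewrite pmh -[pm / p]invrK invf_div lef_pV2 ?posrE ?expR_gt0 ?divr_gt0//.
    by have := expR_ge1Dx (- (p * h)); rewrite ph; lra.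
  move=> hh; have := ler_wpM2r (ltW (G0 _ t0)) qp; move/le_trans; apply.
  by nra.
have stepk k (t : R) : 0 < t -> (q `^ p) ^+ k * G t <= G (q ^+ k * t).
  move=> t0; elim: k => [|k IH]; first by rewrite !expr0 !mul1r.
  rewrite !exprS -!mulrA (le_trans _ (step _ _)) ?mulr_gt0 ?exprn_gt0//.
  by rewrite ler_wpM2l ?powR_ge0.
(* For the least [k] with [1 <= q^k a], minimality gives [q^k a <= q], whence [a^-p G(a) <= q^(k p)
   G(a) <= G(q^k a) <= G(q)]. *)
exists (G q) => [|a /andP[a0 a1]]; first exact: G0.
have [k [ka ak]] : exists k, q ^+ k * a <= q /\ 1 <= q ^+ k * a.
  have ex : exists k, 1 <= q ^+ k * a.
    have [k hk] : exists k, a^-1 <= q ^+ k.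
      have qk k : 1 + k%:R * h <= q ^+ k.
        elim: k => [|k IH]; first by rewrite mul0r addr0 expr0.
        rewrite exprS -natr1; have := ler_wpM2l (ltW q0) IH; apply: le_trans.
        have := ler0n R k; have := h0; rewrite /q; set x := _%:R; nra.
      have /ltW/archi_boundP : 0 < a^-1 / h by rewrite divr_gt0 ?invr_gt0.
      rewrite ltr_pdivrMr// => hk.
      by eexists; apply: le_trans (qk _); rewrite -[leLHS]add0r lerD// ltW//; exact: hk.
    by exists k; rewrite -ler_pdivrMr// mul1r.
  pose k := ex_minn ex; exists k; rewrite /k; case: ex_minnP => -[|m] hm mmin.
    by split => //; rewrite expr0 mul1r (le_trans a1) ?ltW.
  split => //; rewrite exprS -mulrA -[leRHS]mulr1 (ler_wpM2l (ltW q0))// leNgt; apply/negP => /ltW.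
  by move=> /mmin; rewrite ltnn.
have := stepk k a a0.
have qa : 1 <= (q ^+ k * a) `^ p.
  apply: (@le_trans _ _ (1 `^ p)); first by rewrite powR1.
  by rewrite ge0_ler_powR ?nnegrE ?(ltW p0)// (le_trans _ ak).
have -> : (q `^ p) ^+ k = (q ^+ k * a) `^ p / a `^ p.
  rewrite powRM ?exprn_ge0 ?ltW// mulfK ?gt_eqF ?powR_gt0//.
  by rewrite powR_expr// ltW.
move=> hk.
have : (q ^+ k * a) `^ p / a `^ p * G a <= G q.
  by rewrite (le_trans hk)// young_homo// mulr_ge0 ?exprn_ge0 ?ltW.
rewrite mulrAC ler_pdivrMr ?powR_gt0//; apply: le_trans.
by rewrite ler_peMl// ltW// G0.
Qed.

End Young.

(** The ratio bound [a * g a <= pp * G a] passes the power bound from [G] to [g] at the cost of one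
    power; the factor [1 + pp] lets a single constant serve both. *)
Lemma young_density_power_bound (R : realType) (g G : R -> R) (pm pp p : R) :
  young_function g G -> 0 < p -> p < pm ->
  (forall t, 0 < t -> pm <= t * g t / G t <= pp) ->
  exists2 C : R, 0 < C &
    forall a : R, 0 < a <= 1 -> G a <= C * a `^ p /\ g a <= C * a `^ (p - 1).
Proof.
move=> young p0 ppm hpm.
have [C C0 hC] := young_power_bound young pm p p0 ppm (fun t t0 => proj1 (andP (hpm t t0))).
have pp0 : 0 < pp.
  have /andP[h1 h2] := hpm 1 ltr01.
  exact: lt_le_trans (lt_trans p0 ppm) (le_trans h1 h2).
exists (C * (1 + pp)); first by rewrite mulr_gt0// addr_gt0.
move=> a /[dup] /hC Ga /andP[a0 a1].
have ap0 := powR_ge0 a p; have ap'0 := powR_ge0 a (p - 1).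
split.
  rewrite (le_trans Ga)// -mulrA ler_wpM2l ?(ltW C0)//.
  by rewrite mulrDl mul1r lerDl mulr_ge0// ltW.
have /andP[_] := hpm _ a0; rewrite ler_pdivrMr ?(young_gt0 young)// => h.
have : a * g a <= a * (pp * (C * a `^ (p - 1))).
  apply: (le_trans h); rewrite mulrCA ler_wpM2l ?(ltW pp0)// mulrCA.
  by rewrite mulr_powRB1 ?(ltW a0).
rewrite ler_pM2l// => /le_trans; apply.
by rewrite mulrA [pp * C]mulrC ler_wpM2r// ler_wpM2l ?(ltW C0)// lerDr.
Qed.

(** * Euclidean distance and boxes *)

Section Euclid.
Context {R : realType} {n : nat}.
Implicit Types x y : 'rV[R]_n.

Lemma euclidean_norm_ge0 x : 0 <= euclidean_norm x.
Proof. exact: sqrtr_ge0. Qed.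

Lemma le_coord_euclidean_norm x i : `|x ord0 i| <= euclidean_norm x.
Proof.
rewrite -sqrtr_sqr ler_sqrt; last by apply: sumr_ge0 => j _; exact: sqr_ge0.
by rewrite (bigD1 i)//= lerDl sumr_ge0// => j _; exact: sqr_ge0.
Qed.

Lemma euclidean_norm0 : euclidean_norm (0 : 'rV[R]_n) = 0.
Proof. by rewrite /euclidean_norm big1 ?sqrtr0// => i _; rewrite mxE expr0n. Qed.

Lemma euclidean_norm_eq0 x : (euclidean_norm x == 0) = (x == 0).
Proof.
apply/eqP/eqP => [h|->]; last exact: euclidean_norm0.
apply/rowP => i; apply/eqP; rewrite mxE -normr_le0 -h.
exact: le_coord_euclidean_norm.
Qed.

Lemma euclidean_norm_le x M : 0 <= M -> (forall i, `|x ord0 i| <= M) ->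
  euclidean_norm x <= n%:R * M.
Proof.
move=> M0 xM; rewrite -(@ger0_norm _ (n%:R * M)) ?mulr_ge0// -sqrtr_sqr.
rewrite ler_sqrt ?sqr_ge0//.
apply: (@le_trans _ _ (\sum_(i < n) M ^+ 2)).
  apply: ler_sum => i _; rewrite -real_normK ?num_real//.
  by rewrite lerXn2r ?nnegrE.
rewrite sumr_const card_ord -[leLHS]mulr_natl exprMn ler_wpM2r ?sqr_ge0//.
rewrite -natrX ler_nat; case: (n) => // m; exact: leq_pmulr.
Qed.

Lemma measurable_euclidean_normB :
  measurable_fun [set: 'rV[R]_n * 'rV[R]_n] (fun z => euclidean_norm (z.1 - z.2)).
Proof.
have msqrt : measurable_fun [set: R] Num.sqrt.
  by apply: nondecreasing_measurable => // x y xy; exact: ler_wsqrtr.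
apply: (measurableT_comp msqrt).
apply: measurable_sum => i; apply: measurable_funX.
under eq_fun do rewrite !mxE.
by apply: measurable_funB;
  apply: (measurableT_comp (@measurable_rV_coord R n i)).
Qed.

Lemma measurable_div_dist (h : 'rV[R]_n * 'rV[R]_n -> R) : measurable_fun setT h ->
  measurable_fun setT (fun z => h z / euclidean_norm (z.1 - z.2) ^+ n).
Proof.
move=> mh; apply: measurable_funM => //.
(* The inverse distance is written as a real power, known to be measurable; on the diagonal both are
   0. *)
rewrite (_ : (fun _ => _) = (fun z => (euclidean_norm (z.1 - z.2) `^ (- 1)) ^+ n)).
  apply: measurable_funX.
  exact: (measurableT_comp (measurable_powR (- 1)) measurable_euclidean_normB).
by apply/funext => z; rewrite powR_inv1 ?euclidean_norm_ge0// exprVn.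
Qed.

End Euclid.

Section Box.
Context {R : realType} {n : nat}.
Implicit Types (x y : 'rV[R]_n) (r : R).
Local Notation mu := (lebesgue_rV R n).

(** Boxes take the place of Euclidean balls because [lebesgue_rV_box] gives their exact volume. *)
Definition sup_box x r : set 'rV[R]_n :=
  [set y | forall i, `|x ord0 i - y ord0 i| <= r].

Definition sup_strip r : set ('rV[R]_n * 'rV[R]_n) :=
  [set z | sup_box z.1 r z.2].

Lemma measurable_sup_strip r : measurable (sup_strip r).
Proof.
rewrite (_ : sup_strip r = \big[setI/setT]_(i < n)
    [set z : 'rV[R]_n * 'rV[R]_n | `|z.1 ord0 i - z.2 ord0 i| <= r]).
  apply: bigsetI_measurable => i _; rewrite -[X in measurable X]setTI.
  apply: measurable_fun_le => //; apply: measurableT_comp; first exact: normr_measurable.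
  by apply: measurable_funB;
    apply: (measurableT_comp (@measurable_rV_coord R n i)).
rewrite -bigcap_seq; apply/seteqP; split=> z /= h; first by move=> i _; exact: h.
by move=> i; apply: h; rewrite /= mem_index_enum.
Qed.

Lemma measurable_sup_box x r : measurable (sup_box x r).
Proof.
rewrite (_ : sup_box x r = xsection (sup_strip r) x).
  by apply: measurable_xsection; exact: measurable_sup_strip.
by apply/seteqP; split=> y; rewrite /xsection/= inE.
Qed.

Lemma lebesgue_rV_sup_box x r : 0 <= r -> mu (sup_box x r) = ((2 * r) ^+ n)%:E.
Proof.
move=> r0; have -> : sup_box x r =
    [set y | forall i, `[x ord0 i - r, x ord0 i + r]%classic (y ord0 i)].
  by apply/seteqP; split=> y /= h i; have := h i; rewrite in_itv/= ler_distlC.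
rewrite (@lebesgue_rV_box _ _ (fun i => `[x ord0 i - r, x ord0 i + r]%classic))//.
rewrite (eq_bigr (fun=> (2 * r)%:E)) => [|i _].
  by rewrite prodEFin prodr_const card_ord.
rewrite lebesgue_measure_itv/= lte_fin.
case: ltP => [_|h]; first by rewrite -EFinB; congr EFin; lra.
by congr EFin; lra.
Qed.

Lemma sup_box_sym x y r : sup_box x r y -> sup_box y r x.
Proof. by move=> h i; rewrite distrC; exact: h. Qed.

(** Tonelli: the section of the strip at any [x] is a box of volume [(2 r)^n], independent of
    [x]. *)
Lemma integral_sup_strip1 r (w : 'rV[R]_n -> R) : 0 <= r ->
  measurable_fun setT w -> (forall x, 0 <= w x) ->
  (\int[mu \x mu]_z (\1_(sup_strip r) z * w z.1)%:E =
   ((2 * r) ^+ n)%:E * \int[mu]_x (w x)%:E)%E.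
Proof.
move=> r0 mw w0; rewrite fubini_tonelli1//; last 2 first.
- apply/measurable_EFinP; apply: measurable_funM.
    by apply: measurable_indic; exact: measurable_sup_strip.
  exact: (measurableT_comp mw).
- by move=> z; rewrite lee_fin mulr_ge0.
rewrite -ge0_integralZl//; last 3 first.
- exact/measurable_EFinP.
- by move=> x _; rewrite lee_fin.
- by rewrite lee_fin exprn_ge0// mulr_ge0.
apply: eq_integral => x _; rewrite /fubini_F/=.
under eq_integral do rewrite mulrC EFinM.
rewrite ge0_integralZl//; last 2 first.
- apply/measurable_EFinP.
  rewrite (_ : (fun _ => _) = \1_(sup_box x r)); last first.
    by apply/funext => y; rewrite !indicE; congr (_%:R); apply/idP/idP => /=; rewrite !inE.
  by apply: measurable_indic; exact: measurable_sup_box.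
- by rewrite lee_fin.
rewrite muleC; congr (_ * _)%E.
rewrite -(lebesgue_rV_sup_box x)// -[in RHS](setIT (sup_box x r)).
by rewrite -integral_indic//; exact: measurable_sup_box.
Qed.

(** The strip is symmetric, so integrating in the other order reduces this to the first
    coordinate. *)
Lemma integral_sup_strip2 r (w : 'rV[R]_n -> R) : 0 <= r ->
  measurable_fun setT w -> (forall x, 0 <= w x) ->
  (\int[mu \x mu]_z (\1_(sup_strip r) z * w z.2)%:E =
   ((2 * r) ^+ n)%:E * \int[mu]_x (w x)%:E)%E.
Proof.
move=> r0 mw w0.
have mf : measurable_fun setT (fun z : 'rV[R]_n * 'rV[R]_n =>
    (\1_(sup_strip r) z * w z.2)%:E).
  apply/measurable_EFinP; apply: measurable_funM.
    by apply: measurable_indic; exact: measurable_sup_strip.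
  exact: (measurableT_comp mw).
rewrite fubini_tonelli2//; last by move=> z; rewrite lee_fin mulr_ge0.
apply: etrans (integral_sup_strip1 r w r0 mw w0).
rewrite [RHS]fubini_tonelli1; last 2 first.
- apply/measurable_EFinP; apply: measurable_funM.
    by apply: measurable_indic; exact: measurable_sup_strip.
  exact: (measurableT_comp mw).
- by move=> z; rewrite lee_fin mulr_ge0.
apply: eq_integral => y _; rewrite /fubini_G /fubini_F /=.
apply: eq_integral => x _.
suff E : ((x, y) \in sup_strip r) = ((y, x) \in sup_strip r) by rewrite !indicE E.
by apply/idP/idP; rewrite !inE; exact: sup_box_sym.
Qed.

End Box.

(** * Integrability of the singular kernel *)

Lemma dyadic_bracket (R : realType) (d : R) : 1 <= d ->
  exists j, 2 ^+ j <= d < 2 ^+ j.+1.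
Proof.
move=> d1; have ex : exists j, d < 2 ^+ j.
  have /archi_boundP dj : 0 <= d by lra.
  exists (Num.bound d); apply: (lt_trans dj).
  by rewrite -natrX ltr_nat ltn_expl.
case: (ex_minnP ex) => -[|j]; first by rewrite expr0 => /(le_lt_trans d1); rewrite ltxx.
move=> dj jmin; exists j; rewrite dj andbT leNgt; apply/negP => /jmin.
by rewrite ltnn.
Qed.

Lemma nneseries_geometric_ltey (R : realType) (q : R) : 0 <= q < 1 ->
  (\sum_(j <oo) (q ^+ j)%:E < +oo)%E.
Proof.
move=> /andP[q0 q1]; apply: (@le_lt_trans _ _ (1 - q)^-1%:E); last exact: ltry.
apply: lime_le.
  by apply: is_cvg_nneseries => j _ _; rewrite lee_fin exprn_ge0.
apply: nearW => N; rewrite sumEFin lee_fin.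
rewrite -[leRHS]mul1r ler_pdivlMr ?subr_gt0//.
have -> : (\sum_(0 <= i < N) q ^+ i) * (1 - q) = 1 - q ^+ N.
  elim: N => [|N IH]; first by rewrite big_nil mul0r expr0 subrr.
  by rewrite big_nat_recr//= mulrDl IH exprS; ring.
by rewrite gerBl exprn_ge0.
Qed.

Section Kernel.
Context {R : realType} {n : nat}.
Variables (a b : R).
Hypotheses (a0 : 0 < a) (b0 : 0 < b).
Implicit Type z : 'rV[R]_n * 'rV[R]_n.
Local Notation mu := (lebesgue_rV R n).
Local Notation dist z := (euclidean_norm (z.1 - z.2)).

(** The exponent [a] tames the singularity of [|x - y|^-n] on the diagonal, the exponent [- b] its
    tail. With [a = (1 - s) * p - 1] and [b = s] this kernel controls the contribution of the tent
    both to the energy of the truncation and to the tested form. *)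
Definition dist_kernel z : R :=
  Num.min (dist z `^ a) (dist z `^ (- b)) / dist z ^+ n.

Lemma dist_kernel_ge0 z : 0 <= dist_kernel z.
Proof.
by rewrite divr_ge0 ?exprn_ge0 ?euclidean_norm_ge0// le_min !powR_ge0.
Qed.

Lemma measurable_dist_kernel : measurable_fun setT dist_kernel.
Proof.
have md := @measurable_euclidean_normB R n.
have mp c : measurable_fun setT (fun z => dist z `^ c).
  exact: (measurableT_comp (measurable_powR c) md).
exact: (measurable_div_dist _ (measurable_minr (mp a) (mp (- b)))).
Qed.

Let h : R := 2^-1.

Let near_weight j : R := (h `^ a) ^+ j * (2 * 2 ^+ j) ^+ n.
Let far_weight j : R := (h `^ b) ^+ j * (h ^+ j) ^+ n.

Let near_weight_ge0 j : 0 <= near_weight j.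
Proof. by rewrite mulr_ge0// exprn_ge0// ?powR_ge0// mulr_ge0// exprn_ge0. Qed.

Let far_weight_ge0 j : 0 <= far_weight j.
Proof. by rewrite mulr_ge0// exprn_ge0// ?powR_ge0// exprn_ge0// invr_ge0. Qed.

Let dyadic_term j z : R :=
  near_weight j * \1_(sup_strip (h ^+ j)) z +
  far_weight j * \1_(sup_strip (2 * 2 ^+ j)) z.

Let dyadic_term_ge0 j z : 0 <= dyadic_term j z.
Proof. by rewrite addr_ge0// mulr_ge0. Qed.

Let hX j : h ^+ j = (2 ^+ j)^-1.
Proof. by rewrite exprVn. Qed.

Let powR_h c j : (h `^ c) ^+ j = (h ^+ j) `^ c.
Proof.
by rewrite powR_expr// invr_ge0.
Qed.

Let sup_strip_dist r z : dist z <= r -> z \in sup_strip r.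
Proof.
move=> zr; rewrite inE /sup_strip /sup_box /= => i; apply: le_trans zr.
by have := le_coord_euclidean_norm (z.1 - z.2) i; rewrite !mxE.
Qed.

(* [near_weight j] and [far_weight j] bound the kernel on the Euclidean shells
   ]2^-(j+1), 2^-j] and [2^j, 2^(j+1)[. *)
Let dist_kernel_le z : exists j, dist_kernel z <= dyadic_term j z.
Proof.
have : 0 <= dist z by exact: euclidean_norm_ge0.
rewrite le_eqVlt => /predU1P[d0|d0].
  (* On the diagonal the power of exponent [a > 0] is 0, so the kernel vanishes and any index
     works. *)
  exists 0; rewrite /dist_kernel -d0 powR0 ?gt_eqF// min_l ?powR_ge0// mul0r.
  exact: dyadic_term_ge0.
have p2 j : 0 < 2 ^+ j :> R by rewrite exprn_gt0.
have hj j : 0 <= h ^+ j by rewrite hX invr_ge0 ltW.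
have d'0 := ltW d0.
have [d1|/ltW d1] := leP (dist z) 1.
  have /dyadic_bracket[j /andP[jd dj]] : 1 <= (dist z)^-1 by rewrite invf_ge1.
  exists j; apply: (@le_trans _ _ (near_weight j * \1_(sup_strip (h ^+ j)) z)); last first.
    by rewrite lerDl mulr_ge0.
  have dh : dist z <= h ^+ j by rewrite hX -[leLHS]invrK lef_pV2 ?posrE ?invr_gt0.
  rewrite indicE sup_strip_dist// mulr1 /near_weight powR_h.
  apply: ler_pM.
  - by rewrite le_min !powR_ge0.
  - by rewrite invr_ge0 exprn_ge0// ltW.
  - by rewrite ge_min ge0_ler_powR ?nnegrE// ltW.
  - rewrite -exprVn lerXn2r ?nnegrE ?invr_ge0 ?mulr_ge0 ?(ltW (p2 _))//.
    by rewrite -exprS ltW.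
have /dyadic_bracket[j /andP[jd dj]] := d1.
exists j; apply: (@le_trans _ _ (far_weight j * \1_(sup_strip (2 * 2 ^+ j)) z)); last first.
  by rewrite lerDr mulr_ge0.
have dh : dist z <= 2 * 2 ^+ j by rewrite -exprS ltW.
have dV : (dist z)^-1 <= h ^+ j by rewrite hX lef_pV2 ?posrE.
rewrite indicE sup_strip_dist// mulr1 /far_weight powR_h.
apply: ler_pM.
- by rewrite le_min !powR_ge0.
- by rewrite invr_ge0 exprn_ge0// ltW.
- rewrite ge_min; apply/orP; right.
  rewrite powRN -powR_inv1 ?powR_ge0// powRAC powR_inv1//.
  by rewrite ge0_ler_powR ?nnegrE ?invr_ge0// ltW.
- by rewrite -exprVn lerXn2r ?nnegrE ?invr_ge0.
Qed.

Let integral_strip r (w : 'rV[R]_n -> R) (c : R) : 0 <= r -> 0 <= c ->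
  measurable_fun setT w -> (forall x, 0 <= w x) ->
  (\int[mu \x mu]_z (c * \1_(sup_strip r) z * (w z.1 + w z.2))%:E =
   (2 * c * (2 * r) ^+ n)%:E * \int[mu]_x (w x)%:E)%E.
Proof.
move=> r0 c0 mw w0.
have ms : measurable_fun setT (\1_(@sup_strip R n r) : _ -> R).
  by apply: measurable_indic; exact: measurable_sup_strip.
under eq_integral do rewrite -mulrA mulrDr EFinM.
rewrite ge0_integralZl//; last 2 first.
- apply/measurable_EFinP; apply: measurable_funD; apply: measurable_funM => //;
    exact: (measurableT_comp mw).
- by move=> z _; rewrite lee_fin addr_ge0// mulr_ge0.
under eq_integral do rewrite EFinD.
rewrite ge0_integralD//; last 4 first.
- by move=> z _; rewrite lee_fin mulr_ge0.
- by apply/measurable_EFinP; apply: measurable_funM => //; exact: (measurableT_comp mw).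
- by move=> z _; rewrite lee_fin mulr_ge0.
- by apply/measurable_EFinP; apply: measurable_funM => //; exact: (measurableT_comp mw).
rewrite integral_sup_strip1// integral_sup_strip2// -ge0_muleDl ?lee_fin ?exprn_ge0 ?mulr_ge0//.
rewrite -EFinD muleA -EFinM; congr (_%:E * _)%E; ring.
Qed.

(** The volume of the strip sections cancels the [n]-th powers in the dyadic weights up to [4^n].
    What remains are two geometric series of ratios [2^-a] and [2^-b], so [J] does not depend on
    [w]; later this makes it independent of [eps]. *)
Lemma integral_dist_kernel : exists2 J : R, 0 <= J &
  forall w : 'rV[R]_n -> R, measurable_fun setT w -> (forall x, 0 <= w x) ->
  (\int[mu]_x (w x)%:E < +oo)%E ->
  (\int[mu \x mu]_z (dist_kernel z * (w z.1 + w z.2))%:E <=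
   J%:E * \int[mu]_x (w x)%:E)%E.
Proof.
pose q c : R := h `^ c.
have q01 c : 0 < c -> 0 <= q c < 1.
  move=> c0; rewrite powR_ge0/= /q /powR gt_eqF ?invr_gt0//.
  by rewrite expR_lt1 pmulr_rlt0// ln_lt0// invr_gt0// ltr0n/= invf_lt1// ltr1n.
pose c j : \bar R := ((2 * 4 ^+ n)%:E * ((q a ^+ j)%:E + (q b ^+ j)%:E))%E.
have c0 j : (0 <= c j)%E.
  rewrite /c -EFinD -EFinM lee_fin mulr_ge0 ?mulr_ge0 ?exprn_ge0//.
  by rewrite addr_ge0// exprn_ge0 ?powR_ge0.
have cfin : (\sum_(j <oo) c j)%E \is a fin_num.
  rewrite ge0_fin_numE ?nneseries_ge0//.
  rewrite nneseriesZl => [|j _]; last by rewrite -EFinD lee_fin addr_ge0// exprn_ge0 ?powR_ge0.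
  rewrite lte_mul_pinfty ?lee_fin ?mulr_ge0 ?exprn_ge0//.
  rewrite nneseriesD => [|j _ _|j _ _]; try by rewrite lee_fin exprn_ge0 ?powR_ge0.
  by rewrite lte_add_pinfty// nneseries_geometric_ltey// q01.
exists (fine (\sum_(j <oo) c j)%E); first by rewrite fine_ge0// nneseries_ge0.
move=> w mw w0 wfin; rewrite fineK//.
have W0 z : 0 <= w z.1 + w z.2 by rewrite addr_ge0.
have mW : measurable_fun setT (fun z : 'rV[R]_n * 'rV[R]_n => w z.1 + w z.2).
  by apply: measurable_funD; exact: (measurableT_comp mw).
have mt j : measurable_fun setT (fun z => (dyadic_term j z * (w z.1 + w z.2))%:E).
  apply/measurable_EFinP; apply: measurable_funM => //.
  by apply: measurable_funD; apply: measurable_funM => //; apply: measurable_indic;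
    exact: measurable_sup_strip.
have t0 j z : (0 <= (dyadic_term j z * (w z.1 + w z.2))%:E)%E by rewrite lee_fin mulr_ge0.
have intt j : (\int[mu \x mu]_z (dyadic_term j z * (w z.1 + w z.2))%:E =
    c j * \int[mu]_x (w x)%:E)%E.
  under eq_integral do rewrite mulrDl EFinD.
  have ms r : measurable_fun setT (\1_(@sup_strip R n r) : _ -> R).
    by apply: measurable_indic; exact: measurable_sup_strip.
  rewrite ge0_integralD//; last 4 first.
  - by move=> z _; rewrite lee_fin mulr_ge0// mulr_ge0.
  - by apply/measurable_EFinP; apply: measurable_funM => //; exact: measurable_funM.
  - by move=> z _; rewrite lee_fin mulr_ge0// mulr_ge0.
  - by apply/measurable_EFinP; apply: measurable_funM => //; exact: measurable_funM.
  have h0 k : 0 <= h ^+ k by rewrite exprn_ge0// invr_ge0.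
  have t20 k : 0 <= 2 * 2 ^+ k :> R by rewrite mulr_ge0// exprn_ge0.
  rewrite !integral_strip// -ge0_muleDl
    ?lee_fin ?mulr_ge0 ?exprn_ge0 ?mulr_ge0 ?powR_ge0 ?invr_ge0//.
  congr (_ * _)%E; rewrite /c -!EFinD -EFinM; congr EFin.
  rewrite /near_weight /far_weight /q.
  have E1 : (2 * 2 ^+ j) ^+ n * (2 * h ^+ j) ^+ n = 4 ^+ n :> R.
    rewrite -exprMn; congr (_ ^+ n); rewrite hX mulrACA mulfV ?gt_eqF ?exprn_gt0//.
    by ring.
  have E2 : (h ^+ j) ^+ n * (2 * (2 * 2 ^+ j)) ^+ n = 4 ^+ n :> R.
    rewrite -exprMn; congr (_ ^+ n); rewrite hX mulrC -!mulrA mulfV ?gt_eqF ?exprn_gt0//.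
    by ring.
  set A := (h `^ a) ^+ j; set B := (h `^ b) ^+ j.
  rewrite -!mulrA E1 E2; ring.
apply: (@le_trans _ _ (\int[mu \x mu]_z \sum_(j <oo) (dyadic_term j z * (w z.1 + w z.2))%:E)%E).
  apply: ge0_le_integral => //.
  - by move=> z _; rewrite lee_fin mulr_ge0// dist_kernel_ge0.
  - by apply/measurable_EFinP; apply: measurable_funM => //; exact: measurable_dist_kernel.
  - exact: ge0_emeasurable_sum.
  - move=> z _; have [j hj] := dist_kernel_le z.
    apply: (@le_trans _ _ (dyadic_term j z * (w z.1 + w z.2))%:E).
      by rewrite lee_fin ler_wpM2r.
    apply: le_trans (nneseries_lim_ge j.+1 _) => //.
    by rewrite big_nat_recr//= leeDr// sume_ge0.
rewrite integral_nneseries//.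
under eq_eseriesr do rewrite intt muleC.
have : (0 <= \int[mu]_x (w x)%:E)%E by apply: integral_ge0 => x _; rewrite lee_fin.
move: wfin; case: (\int[mu]_x (w x)%:E)%E => // r _ _.
by rewrite nneseriesZl// muleC.
Qed.

End Kernel.

(** * Difference quotients and the sign of minimizers *)

Section Quotient.
Context {R : realType} {n : nat}.
Implicit Types (u v : 'rV[R]_n -> R) (z : 'rV[R]_n * 'rV[R]_n).
Local Notation mu := (lebesgue_rV R n).

Lemma measurable_Dquot s u : measurable_fun setT u -> measurable_fun setT (Dquot s u).
Proof.
move=> mu_; apply: measurable_funM.
  by apply: measurable_funB; exact: (measurableT_comp mu_).
rewrite (_ : (fun _ => _) = (fun z => euclidean_norm (z.1 - z.2) `^ (- s))).
  exact: (measurableT_comp (measurable_powR (- s)) measurable_euclidean_normB).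
by apply/funext => z; rewrite powRN.
Qed.

Lemma normr_Dquot s u z :
  `|Dquot s u z| = `|u z.1 - u z.2| / euclidean_norm (z.1 - z.2) `^ s.
Proof. by rewrite /Dquot normrM normfV [X in _ / X]ger0_norm// powR_ge0. Qed.

Lemma DquotN s u z : Dquot s (fun x => - u x) z = - Dquot s u z.
Proof. by rewrite /Dquot -mulNr opprB opprK addrC. Qed.

Lemma open_sup_box (A : set 'rV[R]_n) x : open A -> A x ->
  exists2 r, 0 < r & sup_box x r `<=` A.
Proof.
rewrite openE => /[apply] /nbhs_ballP[e /= e0 eA].
(* Halving turns the weak inequality of the box into the strict one of the ball. *)
exists (e / 2); first by rewrite divr_gt0.
move=> y xy; apply: eA; split=> // i j; rewrite (ord1 i) /ball /= /ball_.
by rewrite (le_lt_trans (xy j))//; lra.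
Qed.

Lemma sup_boxS x r r' : r <= r' -> @sup_box R n x r `<=` sup_box x r'.
Proof. by move=> rr' y xy i; exact: le_trans rr'. Qed.

Lemma continuous_ge_sup_box u c x : continuous u -> c < u x ->
  exists2 r, 0 < r & forall y, sup_box x r y -> c < u y.
Proof.
move=> cu ux; apply: (@open_sup_box (u @^-1` [set t | c < t])) => //.
by apply: open_comp => // y _; exact: cu.
Qed.

End Quotient.

Section Sign.
Context {R : realType} {n : nat}.
Variables (s : R) (g G : R -> R).
Hypothesis young : young_function g G.
Local Notation mu := (lebesgue_rV R n).
Implicit Types (u v : 'rV[R]_n -> R) (z : 'rV[R]_n * 'rV[R]_n).

Lemma measurable_calF_integrand u : measurable_fun setT u ->
  measurable_fun setT
    (fun z => (G `|Dquot s u z| / euclidean_norm (z.1 - z.2) ^+ n)%:E).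
Proof.
move=> mu_; apply/measurable_EFinP; apply: measurable_div_dist.
apply: (measurableT_comp (measurable_young_norm young)).
exact: measurable_Dquot.
Qed.

Lemma calF_integrand_ge0 u z : 0 <= G `|Dquot s u z| / euclidean_norm (z.1 - z.2) ^+ n.
Proof.
by rewrite divr_ge0 ?exprn_ge0 ?euclidean_norm_ge0// (young_ge0 young).
Qed.

Lemma calF_integrand_le u v z : `|u z.1 - u z.2| <= `|v z.1 - v z.2| ->
  G `|Dquot s u z| / euclidean_norm (z.1 - z.2) ^+ n <=
  G `|Dquot s v z| / euclidean_norm (z.1 - z.2) ^+ n.
Proof.
move=> uv; rewrite ler_wpM2r ?invr_ge0 ?exprn_ge0 ?euclidean_norm_ge0//.
apply: (young_homo young) => //; rewrite !normr_Dquot.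
by rewrite ler_wpM2r// invr_ge0 powR_ge0.
Qed.

(** The integrand for [|u|] is pointwise at most that for [u]. As the energies are finite, equality
    would make the gap vanish almost everywhere; but it is positive on the product of a box where
    [u < 0] and a box where [u > 0], which has positive measure. *)
Lemma calF_norm_lt u : continuous u -> measurable_fun setT u ->
  (calF s G u < +oo)%E -> (exists x, u x < 0) -> (exists x, 0 < u x) ->
  (calF s G (fun x => `|u x|%R) < calF s G u)%E.
Proof.
move=> cu mu_ Fu [x1 ux1] [x2 ux2].
pose f u z := G `|Dquot s u z| / euclidean_norm (z.1 - z.2) ^+ n.
pose v x := `|u x|.
have mv : measurable_fun setT v by exact: measurableT_comp.
have mf w : measurable_fun setT w -> measurable_fun setT (f w).
  by move=> mw; apply/measurable_EFinP; exact: measurable_calF_integrand.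
have vu z : f v z <= f u z.
  apply: calF_integrand_le; rewrite /v; exact: ler_dist_dist.
have le_F : (calF s G v <= calF s G u)%E.
  apply: ge0_le_integral => //.
  - by move=> z _; rewrite lee_fin calF_integrand_ge0.
  - exact: measurable_calF_integrand.
  - exact: measurable_calF_integrand.
  - by move=> z _; rewrite lee_fin; exact: vu.
rewrite lt_neqAle le_F andbT; apply/eqP => eqF.
have fv0 z : 0 <= f v z by exact: calF_integrand_ge0.
have D0 : (\int[mu \x mu]_z (f u z - f v z)%:E = 0)%E.
  have E : (calF s G u = calF s G v + \int[mu \x mu]_z (f u z - f v z)%:E)%E.
    have mfv : measurable_fun setT (EFin \o f v) by apply/measurable_EFinP; exact: mf.
    have mfuv : measurable_fun setT (fun z => (f u z - f v z)%:E).
      by apply/measurable_EFinP; apply: measurable_funB; exact: mf.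
    have fuv0 z : setT z -> (0 <= (f u z - f v z)%:E)%E by rewrite lee_fin subr_ge0.
    have fv0' z : setT z -> (0 <= (EFin \o f v) z)%E by rewrite lee_fin.
    rewrite /calF /iint_nu -(ge0_integralD _ _ fv0' mfv fuv0 mfuv)//.
    by apply: eq_integral => z _; rewrite /= -EFinD [in RHS]addrC subrK.
  have Fv : calF s G v \is a fin_num.
    rewrite ge0_fin_numE ?(le_lt_trans le_F)//.
    by apply: integral_ge0 => z _; rewrite lee_fin calF_integrand_ge0.
  move: E; rewrite -eqF -/v => /(congr1 (fun t => t - calF s G v)%E).
  by rewrite [in RHS]addeAC subee// add0e.
have D1 : (\int[mu \x mu]_z `|(f u z - f v z)%:E| = 0)%E.
  by rewrite -D0; apply: eq_integral => z _; rewrite gee0_abs// lee_fin subr_ge0.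
have : ae_eq (mu \x mu)%E setT (fun z => (f u z - f v z)%:E) (cst 0%E).
  apply/ae_eq_integral_abs => //.
  by apply/measurable_EFinP; apply: measurable_funB; exact: mf.
move=> [N [mN N0 sub]].
have [r1 r10 box1] : exists2 r, 0 < r & forall y, sup_box x1 r y -> 0 < - u y.
  by apply: (@continuous_ge_sup_box _ _ (fun x => - u x)); 
    [move=> x; apply: continuousN; exact: cu|rewrite oppr_gt0].
have [r2 r20 box2] := continuous_ge_sup_box _ _ _ cu ux2.
have m1 := measurable_sup_box x1 r1; have m2 := measurable_sup_box x2 r2.
have : ((mu \x mu) (sup_box x1 r1 `*` sup_box x2 r2) <= (mu \x mu) N)%E.
  apply: le_measure; rewrite ?inE//; first exact: measurableX.
  move=> z [/= /box1 z1 /box2 z2]; apply: sub => /= /(_ I) [] /eqP.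
  rewrite subr_eq0 gt_eqF//.
  have zneq : z.1 - z.2 != 0.
    by rewrite subr_eq0; apply: contraPneq z1 => ->; apply/negP; rewrite -leNgt oppr_le0 ltW.
  have d0 : 0 < euclidean_norm (z.1 - z.2).
    by rewrite lt_neqAle euclidean_norm_ge0 andbT eq_sym euclidean_norm_eq0.
  rewrite ltr_pM2r ?invr_gt0 ?exprn_gt0//.
  apply: (young_strict_homo young) => //.
  rewrite !normr_Dquot ltr_pM2r ?invr_gt0 ?powR_gt0//.
  rewrite /v (gtr0_norm z2) [X in X - _]ltr0_norm; last by rewrite -oppr_gt0.
  rewrite [X in _ < X]ltr0_norm; last by lra.
  by rewrite ltr_norml; lra.
have mu_box_gt0 x r : 0 < r -> (0 < mu (sup_box x r))%E.
  by move=> r0; rewrite lebesgue_rV_sup_box ?ltW// lte_fin exprn_gt0// mulr_gt0.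
by rewrite N0 product_measure1E// leNgt mule_gt0// mu_box_gt0.
Qed.

Lemma minimizer_sign (Omega : set 'rV[R]_n) (m : R) u : 0 < m ->
  is_minimizer s G Omega m u -> continuous u ->
  (forall x, 0 <= u x) \/ (forall x, u x <= 0).
Proof.
move=> m0 [[[[mu_ Gu Fu] u0] Gum] Fmin] cu.
apply: contrapT => /not_orP[/existsNP[x1 /negP]]; rewrite -ltNge => ux1.
move=> /existsNP[x2 /negP]; rewrite -ltNge => ux2.
have Flt := calF_norm_lt u cu mu_ Fu (ex_intro _ x1 ux1) (ex_intro _ x2 ux2).
have GE (U : set 'rV[R]_n) : calG G U (fun x => `|u x|) = calG G U u.
  by rewrite /calG; under eq_integral do rewrite normr_id.
have : (alpha1 s G Omega m <= calF s G (fun x => `|u x|%R) / calG G Omega (fun x => `|u x|%R))%E.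
  apply: ereal_inf_lbound; exists (fun x => `|u x|) => //; split; last by rewrite GE.
  split; first split.
  - exact: measurableT_comp.
  - by rewrite GE.
  - exact: lt_trans Fu.
  - by apply: filterS u0 => x ux /ux ->; rewrite normr0.
(* Both quotients have the same denominator [m > 0], so the strict drop in energy contradicts
   minimality. *)
by rewrite -Fmin GE Gum inver gt_eqF// leNgt lte_pmul2r ?lte_fin ?invr_gt0// Flt.
Qed.

End Sign.

(** * Tents and their difference quotients *)

(** The measurable sets are generated by the coordinates, so an open set has to be exhibited as a
    countable union of boxes; those with centres in [Z^n / (k + 1)] and radius [1 / (k + 1)]
    suffice. *)
Lemma open_measurable_rV (R : realType) (n : nat) (A : set 'rV[R]_n) :
  open A -> measurable A.
Proof.
move=> oA.
pose center (q : 'rV[int]_n * nat) : 'rV[R]_n := \row_i ((q.1 ord0 i)%:~R / q.2.+1%:R).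
pose box q := sup_box (center q) (q.2.+1%:R)^-1.
have -> : A = \bigcup_(q in [set q | box q `<=` A]) box q.
  apply/seteqP; split => [x Ax|x [q qA]]; last exact: qA.
  have [r r0 rA] := open_sup_box _ _ oA Ax.
  have /archi_boundP hk : 0 <= 2 / r by rewrite divr_ge0// ltW.
  pose k := Num.bound (2 / r).
  have k0 : 0 < k.+1%:R :> R by rewrite ltr0n.
  have kr : 2 / k.+1%:R < r.
    rewrite ltr_pdivrMr// mulrC -ltr_pdivrMr//; apply: (lt_trans hk).
    by rewrite ltr_nat.
  (* Rounding down puts the centre within [1 / (k + 1)] of [x] in each coordinate, so the whole box
     stays within [2 / (k + 1) < r] of [x]. *)
  pose q : 'rV[int]_n * nat := (\row_i Num.floor (k.+1%:R * x ord0 i), k).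
  have qx : box q x.
    move=> i; rewrite /= !mxE; set t := k.+1%:R * _.
    have -> : x ord0 i = t / k.+1%:R by rewrite /t mulrAC mulfV ?mul1r ?gt_eqF.
    rewrite -mulrBl normrM [X in _ * X]gtr0_norm ?invr_gt0//.
    rewrite -[leRHS]mul1r ler_wpM2r ?invr_ge0 ?(ltW k0)//.
    have := floor_itv t; rewrite intrD ler_norml => /andP[? ?].
    by apply/andP; split; lra.
  exists q => //= y qy; apply: rA => i; apply: le_trans (ltW kr).
  have -> : x ord0 i - y ord0 i =
    - (center q ord0 i - x ord0 i) + (center q ord0 i - y ord0 i) by ring.
  apply: le_trans (ler_normD _ _) _; rewrite normrN.
  have h1 : `|center q ord0 i - x ord0 i| <= k.+1%:R^-1 := qx i.
  have h2 : `|center q ord0 i - y ord0 i| <= k.+1%:R^-1 := qy i.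
  by apply: (le_trans (lerD h1 h2)); rewrite [in leRHS]mulrC mulr_natr mulr2n.
rewrite bigcup_mkcond; apply: countable_bigcupT_measurable => [|q]; first exact: countableP.
by case: ifPn => // _; exact: measurable_sup_box.
Qed.

Section Tent.
Context {R : realType} {n : nat}.
Hypothesis n0 : (0 < n)%N.
Variables (x0 : 'rV[R]_n) (r : R).
Implicit Types x y : 'rV[R]_n.

(* The l^1 mean of the coordinates is 1-Lipschitz for the Euclidean norm and,
   unlike the library's sup norm, is visibly coordinatewise measurable. *)
Definition tent x : R :=
  Num.max 0 (r - (\sum_(i < n) `|x0 ord0 i - x ord0 i|) / n%:R).

Let n0' : 0 < n%:R :> R. Proof. by rewrite ltr0n. Qed.

Lemma tent_ge0 x : 0 <= tent x.
Proof. by rewrite le_max lexx. Qed.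

Lemma tent_le x : 0 <= r -> tent x <= r.
Proof.
by move=> r0; rewrite ge_max r0 gerBl divr_ge0// sumr_ge0.
Qed.

(** Each coordinate is 1-Lipschitz, and the absolute value, the mean and the positive part all
    preserve this constant. *)
Lemma tent_lipschitz x y : `|tent x - tent y| <= euclidean_norm (x - y).
Proof.
pose e x := (\sum_(i < n) `|x0 ord0 i - x ord0 i|) / n%:R.
have exy : `|e x - e y| <= euclidean_norm (x - y).
  rewrite /e -mulrBl normrM [X in _ * X]gtr0_norm ?invr_gt0// ler_pdivrMr//.
  rewrite -sumrB; apply: le_trans (ler_norm_sum _ _ _) _.
  have -> : euclidean_norm (x - y) * n%:R = \sum_(i < n) euclidean_norm (x - y).
    by rewrite sumr_const card_ord mulr_natr.
  apply: ler_sum => i _; apply: (@le_trans _ _ `|(x - y) ord0 i|).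
    rewrite (le_trans (ler_dist_dist _ _))// !mxE.
    by rewrite (_ : _ - _ = - (x ord0 i - y ord0 i)) ?normrN//; ring.
  exact: le_coord_euclidean_norm.
apply: le_trans exy; rewrite /tent -/(e x) -/(e y).
have [h1|h1] := leP 0 (r - e x); have [h2|h2] := leP 0 (r - e y).
- by rewrite (_ : _ - _ = - (e x - e y)) ?normrN//; ring.
- rewrite subr0 ger0_norm// ler0_norm; lra.
- rewrite sub0r normrN !ger0_norm//; lra.
- by rewrite subrr normr0.
Qed.

(** A mean below [r] bounds a single coordinate only by [n * r], whence the size of the box. *)
Lemma tent_support x : 0 < tent x -> sup_box x0 (n%:R * r) x.
Proof.
rewrite lt_max ltxx/= subr_gt0 ltr_pdivrMr// mulrC => xr i.
apply: le_trans (ltW xr); rewrite (bigD1 i)//= lerDl.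
by apply: sumr_ge0 => j _.
Qed.

Lemma tent_ge_half x : sup_box x0 (r / 2) x -> r / 2 <= tent x.
Proof.
move=> xr; rewrite le_max; apply/orP; right.
have : (\sum_(i < n) `|x0 ord0 i - x ord0 i|) / n%:R <= r / 2.
  rewrite ler_pdivrMr//.
  have -> : r / 2 * n%:R = \sum_(i < n) r / 2.
    by rewrite sumr_const card_ord mulr_natr.
  exact: ler_sum.
lra.
Qed.

Lemma measurable_tent : measurable_fun setT tent.
Proof.
apply: measurable_maxr => //; apply: measurable_funB => //.
apply: measurable_funM => //; apply: measurable_sum => i.
apply: measurableT_comp => //; apply: measurable_funB => //.
exact: (@measurable_rV_coord R n i).
Qed.

End Tent.

Section Slope.
Context {R : realType}.
Variables s p : R.
Hypotheses (s0 : 0 < s) (s1 : s < 1) (p1 : 1 < p) (ps : 1 < (1 - s) * p).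
Implicit Type d : R.

(* A 1-Lipschitz function with values in [0, 1] has difference quotients of
   order s bounded by slope d at distance d. *)
Definition slope d : R := Num.min 1 d / d `^ s.

Lemma slope_gt0 d : 0 < d -> 0 < slope d.
Proof. by move=> d0; rewrite divr_gt0 ?powR_gt0// lt_min ltr01. Qed.

Lemma slope_le d : 0 < d -> slope d <= d `^ (- s).
Proof.
move=> d0; rewrite /slope powRN -[leRHS]mul1r ler_wpM2r ?invr_ge0 ?powR_ge0//.
by rewrite ge_min lexx.
Qed.

Let slope_small d : 0 < d -> d <= 1 -> slope d = d `^ (1 - s).
Proof.
move=> d0 d1; rewrite /slope min_r// powRB ?powRr1 ?ltW//.
by rewrite gt_eqF ?implybT.
Qed.

Lemma slope_le1 d : 0 < d -> slope d <= 1.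
Proof.
move=> d0; apply: (@le_trans _ _ (d `^ 0)); last by rewrite powRr0.
have [d1|/ltW d1] := leP d 1.
  by rewrite slope_small// ger_powR ?d0 ?d1// subr_ge0 ltW.
by rewrite (le_trans (slope_le d d0))// ler_powR// oppr_le0 ltW.
Qed.

(** For [d <= 1] the slope is [d^(1 - s)], and [(1 - s) * (p - 1) - s = (1 - s) * p - 1]; for
    [d >= 1] it is at most 1, which leaves [d^-s]. The inequality between the two exponents tells
    which of them is the minimum. *)
Lemma slope_powR_le d : 0 < d ->
  slope d `^ (p - 1) * d `^ (- s) <=
  Num.min (d `^ ((1 - s) * p - 1)) (d `^ (- s)).
Proof.
have e : - s <= (1 - s) * p - 1 by move: ps s0; set t := _ * p; lra.
have p0 : 0 <= p - 1 by rewrite subr_ge0 ltW.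
move=> d0; rewrite le_min; have [d1|/ltW d1] := leP d 1.
  have -> : slope d `^ (p - 1) * d `^ (- s) = d `^ ((1 - s) * p - 1).
    rewrite slope_small// -powRrM -powRD ?(gt_eqF d0) ?implybT//.
    by congr (_ `^ _); ring.
  by rewrite lexx/= ger_powR ?d0 ?d1.
have h : slope d `^ (p - 1) * d `^ (- s) <= d `^ (- s).
  rewrite -[leRHS]mul1r ler_wpM2r ?powR_ge0//.
  apply: (@le_trans _ _ (1 `^ (p - 1))); last by rewrite powR1.
  by rewrite ge0_ler_powR ?nnegrE ?slope_le1 ?(ltW (slope_gt0 d d0)).
by rewrite h andbT (le_trans h)// ler_powR.
Qed.

(** One factor of the slope is traded for [d^-s], so the kernel for the form, of power [p - 1], also
    serves the energy, of power [p]. *)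
Lemma slope_powR_le' d : 0 < d ->
  slope d `^ p <= Num.min (d `^ ((1 - s) * p - 1)) (d `^ (- s)).
Proof.
move=> d0; apply: le_trans (slope_powR_le d d0).
rewrite -(mulr_powRB1 (ltW (slope_gt0 d d0)) (lt_trans ltr01 p1)).
by rewrite mulrC ler_wpM2l ?powR_ge0// slope_le.
Qed.

End Slope.

(** * The truncation at a zero of a nonnegative eigenfunction *)

Section Truncation.
Context {R : realType} {n : nat}.
Variables (s p C : R) (g G : R -> R) (u : 'rV[R]_n -> R).
Variables (x0 : 'rV[R]_n) (r eps : R).
Hypotheses (n0 : (0 < n)%N) (s0 : 0 < s) (s1 : s < 1).
Hypotheses (p1 : 1 < p) (ps : 1 < (1 - s) * p).
Hypotheses (young : young_function g G) (C0 : 0 < C).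
Hypothesis hC : forall a : R, 0 < a <= 1 ->
  G a <= C * a `^ p /\ g a <= C * a `^ (p - 1).
Hypotheses (mu_ : measurable_fun setT u) (u0 : forall x, 0 <= u x).
Hypotheses (r0 : 0 < r) (r1 : r <= 1) (e0 : 0 < eps) (e1 : eps <= 1).
Implicit Type z : 'rV[R]_n * 'rV[R]_n.
Local Notation mu := (lebesgue_rV R n).
Local Notation dist z := (euclidean_norm (z.1 - z.2)).
Local Notation phi := (tent x0 r).
Local Notation B := (sup_box x0 (n%:R * r)).
Local Notation K := (dist_kernel ((1 - s) * p - 1) s).

(* Halving makes the difference quotients of the truncation a mean of those of
   [u] and of the tent, so that no doubling property of [G] is needed. *)
Definition truncation x : R := Num.max 0 (eps * phi x - u x) / 2.
Local Notation v := truncation.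

Lemma truncation_ge0 x : 0 <= v x.
Proof. by rewrite divr_ge0// le_max lexx. Qed.

Lemma truncation_gt0 x : 0 < v x -> u x = eps * phi x - 2 * v x /\ B x.
Proof.
rewrite /truncation; case: (leP 0 (eps * phi x - u x)) => [h vx|_]; last first.
  by rewrite mul0r ltxx.
split; first by field.
apply: tent_support => //; rewrite -(pmulr_rgt0 _ e0).
have := u0 x; lra.
Qed.

Lemma truncation_eq0 x : ~ B x -> v x = 0.
Proof.
move=> Bx; apply/eqP; rewrite eq_le truncation_ge0 andbT leNgt.
by apply/negP => /truncation_gt0[].
Qed.

(** Together with the equality of [truncation_gt0] at the point of larger truncation, this bounds
    the increment of [u] by that of [eps * phi]. *)
Lemma truncation_ge x : eps * phi x - 2 * v x <= u x.
Proof.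
rewrite /truncation mulrCA divff// mulr1.
have : eps * phi x - u x <= Num.max 0 (eps * phi x - u x) by rewrite le_max lexx orbT.
lra.
Qed.

Lemma truncation_le1 x : v x <= 1.
Proof.
rewrite /truncation ler_pdivrMr// mul1r ge_max ler0n/=.
have : eps * phi x <= 1 * 1.
  by apply: ler_pM; rewrite ?tent_ge0 ?(ltW e0)// (le_trans (tent_le _ _ _ (ltW r0))).
have := u0 x; lra.
Qed.

Lemma truncation_le_indic x : v x <= \1_B x.
Proof.
rewrite indicE; case: (boolP (x \in B)) => [_|]; first exact: truncation_le1.
by rewrite notin_setE => /truncation_eq0 ->.
Qed.

Lemma measurable_truncation : measurable_fun setT v.
Proof.
apply: measurable_funM => //; apply: measurable_maxr => //.
apply: measurable_funB => //; apply: measurable_funM => //.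
exact: measurable_tent.
Qed.

Lemma truncation_dist x y :
  `|v x - v y| <= (`|u x - u y| + eps * `|phi x - phi y|) / 2.
Proof.
rewrite /truncation -mulrBl normrM [X in _ * X]gtr0_norm ?invr_gt0//.
rewrite ler_wpM2r ?invr_ge0//.
have -> : eps * `|phi x - phi y| = `|eps * phi x - eps * phi y|.
  by rewrite -mulrBr normrM gtr0_norm.
move: (eps * phi x) (eps * phi y) => a b.
apply: (@le_trans _ _ `|(a - u x) - (b - u y)|); last first.
  rewrite (_ : _ - _ = (a - b) - (u x - u y)); last by ring.
  by rewrite (le_trans (ler_normB _ _))// addrC.
have [h1|h1] := leP 0 (a - u x); have [h2|h2] := leP 0 (b - u y).
- by [].
- rewrite subr0 !ger0_norm//; lra.
- rewrite sub0r normrN ger0_norm// ler0_norm; lra.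
- by rewrite subrr normr0.
Qed.

Lemma tent_slope z : 0 < dist z ->
  `|phi z.1 - phi z.2| / dist z `^ s <= slope s (dist z).
Proof.
move=> d0; rewrite ler_wpM2r ?invr_ge0 ?powR_ge0// le_min tent_lipschitz// andbT.
have t0 x := tent_ge0 x0 r x; have tr x := tent_le x0 r x (ltW r0).
have := r1; have := t0 z.1; have := t0 z.2; have := tr z.1; have := tr z.2.
by rewrite ler_norml; lra.
Qed.

Let epsslope d : 0 < d -> 0 < eps * slope s d <= 1.
Proof.
move=> d0; rewrite mulr_gt0 ?slope_gt0//=.
by rewrite -[leRHS](mulr1 1) ler_pM ?(ltW e0) ?(ltW (slope_gt0 _ _ _))// slope_le1.
Qed.

Lemma Dquot_diag w z : dist z = 0 -> Dquot s w z = 0.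
Proof.
move=> /eqP; rewrite euclidean_norm_eq0 subr_eq0 => /eqP zz.
by rewrite /Dquot zz subrr mul0r.
Qed.

(** [young_half_le] splits off [G (eps * slope)], which the power bound on [G] compares with the
    kernel. Where the quotient of [v] is nonzero, one of the two points lies in [B], so the sum of
    indicators is at least 1. *)
Lemma calF_truncation_le z :
  G `|Dquot s v z| / dist z ^+ n <=
  G `|Dquot s u z| / dist z ^+ n + C * (K z * (\1_B z.1 + \1_B z.2)).
Proof.
have G0 w : 0 <= G `|Dquot s w z| / dist z ^+ n.
  by rewrite divr_ge0 ?exprn_ge0 ?euclidean_norm_ge0// (young_ge0 young).
have K0 : 0 <= K z by exact: dist_kernel_ge0.
have [->|D0] := eqVneq (Dquot s v z) 0.
  by rewrite normr0 (young0 young) mul0r addr_ge0// mulr_ge0 ?(ltW C0)// mulr_ge0 ?addr_ge0.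
have d0 : 0 < dist z.
  rewrite lt_neqAle euclidean_norm_ge0 andbT; apply: contraNneq D0 => /esym.
  by move=> /Dquot_diag ->.
have indic1 : 1 <= \1_B z.1 + \1_B z.2 :> R.
  rewrite !indicE; have [|B1] := boolP (z.1 \in B); first by rewrite lerDl.
  have [|B2] := boolP (z.2 \in B); first by rewrite lerDr.
  move: D0 B1 B2; rewrite !notin_setE => + /truncation_eq0 v1 /truncation_eq0 v2.
  by rewrite /Dquot v1 v2 subrr mul0r eqxx.
have /andP[es0 es1] := epsslope _ d0.
have GD : G `|Dquot s v z| <= G `|Dquot s u z| + G (eps * slope s (dist z)).
  apply: (young_half_le young) => //; first exact: ltW.
  rewrite !normr_Dquot; have dV : 0 <= (dist z `^ s)^-1 by rewrite invr_ge0 powR_ge0.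
  apply: (le_trans (ler_wpM2r dV (truncation_dist z.1 z.2))).
  rewrite mulrAC ler_wpM2r ?invr_ge0// mulrDl lerD2l -mulrA ler_wpM2l ?(ltW e0)//.
  exact: tent_slope.
rewrite (le_trans (ler_wpM2r _ GD)) ?invr_ge0 ?exprn_ge0 ?(ltW d0)// mulrDl lerD2l.
apply: (@le_trans _ _ (C * K z)); last first.
  by rewrite ler_wpM2l ?(ltW C0)// ler_peMr.
rewrite /dist_kernel [leRHS]mulrA ler_wpM2r ?invr_ge0 ?exprn_ge0 ?(ltW d0)//.
have [h _] := hC _ (epsslope _ d0).
rewrite (le_trans h)// ler_wpM2l ?(ltW C0)//.
apply: le_trans (slope_powR_le' _ _ s0 s1 p1 ps _ d0).
have p0 : 0 <= p by rewrite ltW// (lt_trans ltr01).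
have sl := slope_gt0 s _ d0.
by rewrite ge0_ler_powR ?nnegrE ?(ltW es0) ?(ltW sl)// ler_piMl ?(ltW sl).
Qed.

(** Let [v y < v x]. Then [u x - u y <= eps * (phi x - phi y)], so the density factor is at most
    [g (eps * slope)], which the power bound turns into [eps^(p - 1) * slope^(p - 1)]. The other
    factor is at most [(v x + v y) * d^-s], and [slope_powR_le] recovers the kernel. *)
Lemma form_truncation_le z :
  signed_density g (Dquot s u z) * Dquot s v z / dist z ^+ n <=
  C * eps `^ (p - 1) * (K z * (v z.1 + v z.2)).
Proof.
have K0 : 0 <= K z by exact: dist_kernel_ge0.
have v0 := truncation_ge0.
have rhs0 : 0 <= C * eps `^ (p - 1) * (K z * (v z.1 + v z.2)).
  have vv := addr_ge0 (v0 z.1) (v0 z.2).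
  exact: (mulr_ge0 (mulr_ge0 (ltW C0) (powR_ge0 _ _)) (mulr_ge0 K0 vv)).
have [->|D0] := eqVneq (Dquot s v z) 0; first by rewrite mulr0 mul0r.
have d0 : 0 < dist z.
  rewrite lt_neqAle euclidean_norm_ge0 andbT; apply: contraNneq D0 => /esym.
  by move=> /Dquot_diag ->.
have p0 : 0 <= p - 1 by rewrite subr_ge0 ltW.
have sl := slope_gt0 s _ d0.
have dV : 0 <= (dist z `^ s)^-1 by rewrite invr_ge0 powR_ge0.
have /andP[es0 es1] := epsslope _ d0.
have gs : g (eps * slope s (dist z)) <= C * eps `^ (p - 1) * slope s (dist z) `^ (p - 1).
  have [_ h] := hC _ (epsslope _ d0); apply: (le_trans h).
  by rewrite -mulrA powRM ?(ltW e0) ?(ltW sl).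
have key (x y : 'rV[R]_n) : v y < v x ->
    `|phi x - phi y| / dist z `^ s <= slope s (dist z) ->
    signed_density g ((u x - u y) / dist z `^ s) * ((v x - v y) / dist z `^ s) <=
    C * eps `^ (p - 1) * slope s (dist z) `^ (p - 1) *
      ((v x + v y) * dist z `^ (- s)).
  move=> vxy sxy; rewrite powRN.
  apply: (@le_trans _ _ (g (eps * slope s (dist z)) * ((v x - v y) / dist z `^ s))).
    rewrite ler_wpM2r ?mulr_ge0 ?subr_ge0 ?(ltW vxy)//.
    apply: (signed_density_le young); last exact: ltW.
    apply: (@le_trans _ _ (eps * (`|phi x - phi y| / dist z `^ s))); last first.
      by rewrite ler_wpM2l ?(ltW e0).
    rewrite mulrA ler_wpM2r//.
    have [ux _] := truncation_gt0 x (le_lt_trans (v0 y) vxy).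
    have uy := truncation_ge y.
    have : eps * (phi x - phi y) <= eps * `|phi x - phi y|.
      by rewrite ler_wpM2l ?(ltW e0)// ler_norm.
    rewrite mulrBr ux; lra.
  apply: ler_pM => //.
  - exact/(young_density_ge0 young)/ltW.
  - by rewrite mulr_ge0// subr_ge0 ltW.
  - by rewrite ler_wpM2r// lerD2l (le_trans _ (v0 y))// oppr_le0.
have fin : signed_density g (Dquot s u z) * Dquot s v z <=
    C * eps `^ (p - 1) * slope s (dist z) `^ (p - 1) *
      ((v z.1 + v z.2) * dist z `^ (- s)).
  have := tent_slope z d0.
  (* Exchanging the two points changes the sign of both quotients, hence not the product. *)
  have [vlt|vlt|veq] := ltgtP (v z.1) (v z.2).
  - move=> h; rewrite [v z.1 + _]addrC.
    have := key z.2 z.1 vlt; rewrite distrC => /(_ h); apply: le_trans.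
    rewrite /Dquot -[u z.1 - _]opprB -[v z.1 - _]opprB !mulNr signed_densityN.
    by rewrite mulrNN.
  - exact: key.
  - by move: D0; rewrite /Dquot veq subrr mul0r eqxx.
rewrite (le_trans (ler_wpM2r _ fin)) ?invr_ge0 ?exprn_ge0 ?(ltW d0)//.
rewrite -!mulrA ler_wpM2l ?(ltW C0)// ler_wpM2l ?powR_ge0// /dist_kernel.
have := slope_powR_le _ _ s0 s1 p1 ps _ d0.
set a := slope _ _ `^ _; set b := _ `^ (- s); set m := Num.min _ _ => abm.
rewrite (_ : a * _ = a * b * ((dist z ^+ n)^-1 * (v z.1 + v z.2))); last by ring.
by rewrite ler_wpM2r// mulr_ge0 ?addr_ge0// invr_ge0 exprn_ge0// (ltW d0).
Qed.

End Truncation.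

(** * Sign of the eigenvalue and admissible test functions *)

Section PositiveIntegral.
Context {R : realType} {n : nat}.
Local Notation mu := (lebesgue_rV R n).

Lemma integral_gt0_box (D : set 'rV[R]_n) (f : 'rV[R]_n -> R) x r c :
  measurable D -> measurable_fun D f -> (forall y, D y -> 0 <= f y) ->
  0 < r -> 0 < c -> sup_box x r `<=` D -> (forall y, sup_box x r y -> c <= f y) ->
  (0 < \int[mu]_(y in D) (f y)%:E)%E.
Proof.
move=> mD mf f0 r0 c0 BD fc.
have mB := measurable_sup_box x r.
apply: (@lt_le_trans _ _ (\int[mu]_(y in sup_box x r) (f y)%:E)%E); last first.
  apply: ge0_subset_integral => //; exact/measurable_EFinP.
apply: (@lt_le_trans _ _ (\int[mu]_(y in sup_box x r) (cst c%:E y))%E).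
  have -> : (\int[mu]_(y in sup_box x r) (cst c%:E y) = c%:E * mu (sup_box x r))%E.
    exact: integral_cst.
  rewrite lebesgue_rV_sup_box ?(ltW r0)// -EFinM lte_fin.
  by rewrite mulr_gt0// exprn_gt0// mulr_gt0.
apply: ge0_le_integral => //.
- by move=> y _; rewrite lee_fin ltW.
- by apply/measurable_EFinP; exact: measurable_funS mf.
Qed.

Lemma integral_indic_sup_box x r : 0 <= r ->
  (\int[mu]_y (\1_(sup_box x r) y)%:E = ((2 * r) ^+ n)%:E)%E.
Proof.
move=> r0; rewrite integral_indic//; last exact: measurable_sup_box.
by rewrite setIT; exact: lebesgue_rV_sup_box.
Qed.

End PositiveIntegral.

Section Core.
Context {R : realType} {n : nat}.
Local Notation mu := (lebesgue_rV R n).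
Local Notation dist z := (euclidean_norm (z.1 - z.2)).
Implicit Types (Omega : set 'rV[R]_n) (u : 'rV[R]_n -> R).

(** In the equation tested with [u] the form is nonnegative, and the integral that multiplies
    [lambda] is positive because [u > u x1 / 2] on a box around [x1]. *)
Lemma eigenvalue_ge0 s g G Omega lambda u x1 :
  young_function g G -> open Omega -> WsG0 s G Omega u ->
  eigen_equation s g G Omega lambda u -> continuous u ->
  (forall x, 0 <= u x) -> Omega x1 -> 0 < u x1 -> 0 <= lambda.
Proof.
move=> young oO Wu eigen cu u0 Ox1 ux1; rewrite leNgt; apply/negP => l0.
have mu_ : measurable_fun setT u by case: Wu => -[].
have sd0 a : 0 <= signed_density g a * a.
  have [->|a0] := eqVneq a 0; first by rewrite mulr0.
  exact/ltW/(signed_density_mul_gt0 young).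
have : (0 <= iint_nu (fun z => signed_density g (Dquot s u z) * Dquot s u z)%R)%E.
  apply: integral_ge0 => z _; rewrite lee_fin divr_ge0// exprn_ge0//.
  exact: euclidean_norm_ge0.
rewrite (eigen _ Wu) leNgt nmule_rlt0 ?lte_fin//.
suff -> : (0 < \int[mu]_(x in Omega) (signed_density g (u x) * u x)%:E)%E by [].
have [r1 r10 B1] := open_sup_box _ _ oO Ox1.
have ux12 : u x1 / 2 < u x1 by lra.
have [r2 r20 B2] := continuous_ge_sup_box _ _ _ cu ux12.
have c0 : 0 < u x1 / 2 by rewrite divr_gt0.
apply: (@integral_gt0_box _ _ _ _ x1 (Num.min r1 r2)
    (signed_density g (u x1 / 2) * (u x1 / 2))).
- exact: open_measurable_rV.
- apply: measurable_funTS; apply: measurable_funM => //.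
  exact: (measurableT_comp (measurable_signed_density young)).
- by move=> y _; exact: sd0.
- by rewrite lt_min r10.
- by apply: (signed_density_mul_gt0 young); rewrite gt_eqF.
- by apply: subset_trans B1; apply: sup_boxS; rewrite ge_min lexx.
- move=> y /sup_boxS yB; have /B2 uy : sup_box x1 r2 y.
    by apply: yB; rewrite ge_min lexx orbT.
  apply: ler_pM => //; [|exact: ltW| |exact: ltW].
    by apply: (signed_density_ge0 young); exact: ltW.
  by apply: (signed_density_homo young); exact: ltW.
Qed.

Lemma WsG0_opp s G Omega u : WsG0 s G Omega u -> WsG0 s G Omega (fun x => - u x).
Proof.
move=> [[mu_ Gu Fu] u0]; split; first split.
- exact: measurableT_comp.
- by rewrite /calG; under eq_integral do rewrite normrN.
- rewrite /calF (_ : (fun _ => _) = (fun z => G `|Dquot s u z|))//.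
  by apply/funext => z; rewrite DquotN normrN.
- by apply: filterS u0 => x ux /ux ->; rewrite oppr0.
Qed.

(** The density is odd, so the equation for [- u] tested with [v] is the equation for [u] tested
    with [- v]. *)
Lemma eigen_equation_opp s g G Omega lambda u :
  eigen_equation s g G Omega lambda u ->
  eigen_equation s g G Omega lambda (fun x => - u x).
Proof.
move=> eigen v /WsG0_opp/eigen.
rewrite (_ : (fun z => _ * Dquot s (fun x => - v x) z) =
  (fun z => signed_density g (Dquot s (fun x => - u x) z) * Dquot s v z)); last first.
  by apply/funext => z; rewrite !DquotN signed_densityN mulrN mulNr.
move=> ->; congr (_ * _)%E; apply: eq_integral => x _.
by rewrite signed_densityN mulrN mulNr.
Qed.

(** Since [0 <= v <= 1] and [v] vanishes off a box in [Omega], [G (v)] is dominated by [G 1] times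
    an indicator. The energy exceeds that of [u] by at most the kernel integrated against the
    indicator of the box. *)
Lemma WsG0_truncation s p C g G Omega u x0 r eps :
  (0 < n)%N -> 0 < s -> s < 1 -> 1 < p -> 1 < (1 - s) * p ->
  young_function g G -> 0 < C ->
  (forall a : R, 0 < a <= 1 -> G a <= C * a `^ p /\ g a <= C * a `^ (p - 1)) ->
  (forall x, 0 <= u x) -> 0 < r -> r <= 1 -> 0 < eps -> eps <= 1 ->
  sup_box x0 (n%:R * r) `<=` Omega -> WsG0 s G Omega u ->
  WsG0 s G Omega (truncation u x0 r eps).
Proof.
move=> n0 s0 s1 p1 ps young C0 hC u0 r0 r1 e0 e1 BO [[mu_ Gu Fu] uO].
set v := truncation u x0 r eps; set B := sup_box x0 (n%:R * r).
have nr0 : 0 <= n%:R * r by rewrite mulr_ge0// ltW.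
have mv : measurable_fun setT v by exact: measurable_truncation.
have v0 : forall x, 0 <= v x by exact: truncation_ge0.
have vB : forall x, v x <= \1_B x by exact: truncation_le_indic.
have mB : measurable_fun setT (\1_B : _ -> R).
  by apply: measurable_indic; exact: measurable_sup_box.
split; last first.
  by apply: aeW => x Ox; apply: truncation_eq0 => // Bx; apply: Ox; exact: BO.
split => //.
  apply: (@le_lt_trans _ _ (\int[mu]_x ((G 1)%:E * (\1_B x)%:E))%E).
    apply: ge0_le_integral => //.
    - by move=> x _; rewrite lee_fin (young_ge0 young).
    - apply/measurable_EFinP.
      exact: (measurableT_comp (measurable_young_norm young)).
    - by apply/measurable_EFinP; exact: measurable_funM.
    - move=> x _; rewrite -EFinM lee_fin ger0_norm// indicE.
      case: (boolP (x \in B)) => [_|].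
        by rewrite mulr1 (young_homo young)// (le_trans (vB x))// indicE lern1 leq_b1.
      rewrite notin_setE => Bx; rewrite mulr0 /v truncation_eq0//.
      by rewrite (young0 young).
  rewrite ge0_integralZl//; last 2 first.
  - exact/measurable_EFinP.
  - by rewrite lee_fin (young_ge0 young).
  by rewrite integral_indic_sup_box// -EFinM ltry.
have d0 : 0 < (1 - s) * p - 1 by rewrite subr_gt0.
have [J J0 hJ] := @integral_dist_kernel R n _ _ d0 s0.
pose K := dist_kernel ((1 - s) * p - 1) s : 'rV[R]_n * 'rV[R]_n -> R.
have mKB : measurable_fun setT (fun z => K z * (\1_B z.1 + \1_B z.2)).
  apply: measurable_funM; first exact: measurable_dist_kernel.
  by apply: measurable_funD; exact: (measurableT_comp mB).
have KB0 z : 0 <= K z * (\1_B z.1 + \1_B z.2).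
  by rewrite mulr_ge0 ?dist_kernel_ge0// addr_ge0.
apply: (@le_lt_trans _ _ (calF s G u + C%:E * \int[mu \x mu]_z (K z * (\1_B z.1 + \1_B z.2))%:E)%E).
  rewrite /calF /iint_nu -ge0_integralZl//; last 3 first.
  - exact/measurable_EFinP.
  - by move=> z _; rewrite lee_fin.
  - by rewrite lee_fin ltW.
  rewrite -ge0_integralD//; last 4 first.
  - by move=> z _; rewrite lee_fin (calF_integrand_ge0 _ _ _ young).
  - exact: (measurable_calF_integrand _ _ _ young).
  - by move=> z _; rewrite -EFinM lee_fin mulr_ge0// ltW.
  - by apply/measurable_EFinP; exact: measurable_funM.
  apply: ge0_le_integral => //.
  - by move=> z _; rewrite lee_fin (calF_integrand_ge0 _ _ _ young).
  - exact: (measurable_calF_integrand _ _ _ young).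
  - apply: emeasurable_funD.
      exact: (measurable_calF_integrand _ _ _ young).
    by apply/measurable_EFinP; exact: measurable_funM.
  - move=> z _; rewrite -EFinM -EFinD lee_fin.
    exact: (@calF_truncation_le _ _ s p C g G).
apply: lte_add_pinfty => //; apply: lte_mul_pinfty; rewrite ?lee_fin ?(ltW C0)//.
have fB : (\int[mu]_x (\1_B x)%:E < +oo)%E by rewrite integral_indic_sup_box// ltry.
apply: le_lt_trans (hJ _ mB _ fB) _ => //.
by rewrite integral_indic_sup_box// -EFinM ltry.
Qed.

End Core.

(** * Strict positivity of nonnegative eigenfunctions *)

Section Positivity.
Context {R : realType} {n : nat}.
Local Notation mu := (lebesgue_rV R n).
Local Notation dist z := (euclidean_norm (z.1 - z.2)).
Implicit Types (Omega : set 'rV[R]_n) (u : 'rV[R]_n -> R).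

(** The density is at most [- g (c / D^s)] and every inverse power of the distance is at least that
    of [D]. This is the favourable negative part of the form, linear in [v] with a coefficient free
    of [v]. *)
Lemma form_away_le s (g G : R -> R) u (v : 'rV[R]_n -> R) c D z :
  young_function g G -> 0 < s -> 0 < c -> 0 < D ->
  0 <= v z.1 -> v z.2 = 0 -> u z.1 - u z.2 <= - c -> dist z <= D ->
  g (c / D `^ s) / D `^ s / D ^+ n * v z.1 <=
  - (signed_density g (Dquot s u z) * Dquot s v z / dist z ^+ n).
Proof.
move=> young s0 c0 D0 v0 vz uz dD.
have d0 : 0 < dist z.
  rewrite lt_neqAle euclidean_norm_ge0 andbT eq_sym euclidean_norm_eq0 subr_eq0.
  by apply/eqP => zz; move: uz; rewrite zz subrr oppr_ge0 leNgt c0.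
have ds0 : 0 < dist z `^ s by rewrite powR_gt0.
have Ds0 : 0 < D `^ s by rewrite powR_gt0.
have dsD : (D `^ s)^-1 <= (dist z `^ s)^-1.
  by rewrite lef_pV2 ?posrE// ge0_ler_powR ?nnegrE ?(ltW s0) ?(ltW d0) ?(ltW D0).
have dnD : (D ^+ n)^-1 <= (dist z ^+ n)^-1.
  by rewrite lef_pV2 ?posrE ?exprn_gt0// lerXn2r ?nnegrE ?(ltW d0) ?(ltW D0).
have cD0 : 0 < c / D `^ s by rewrite divr_gt0.
have gD : g (c / D `^ s) <= - signed_density g (Dquot s u z).
  rewrite -(signed_density_pos (g := g) _ cD0) -signed_densityN.
  apply: (signed_density_homo young); rewrite /Dquot -mulNr.
  by rewrite ler_pM ?(ltW c0) ?invr_ge0 ?(ltW Ds0)// lerNr.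
have g0 : 0 <= g (c / D `^ s) by rewrite (young_density_ge0 young)// ltW.
have -> : g (c / D `^ s) / D `^ s / D ^+ n * v z.1 =
    g (c / D `^ s) * (v z.1 / D `^ s) / D ^+ n by ring.
have DsV : 0 <= (D `^ s)^-1 by rewrite invr_ge0 ltW.
have DnV : 0 <= (D ^+ n)^-1 by rewrite invr_ge0 exprn_ge0 ?(ltW D0).
rewrite [Dquot s v z]/Dquot vz subr0 -2!mulNr.
have vD := mulr_ge0 v0 DsV.
exact: (ler_pM (mulr_ge0 g0 vD) DnV (ler_pM g0 vD gD (ler_wpM2l v0 dsD)) dnD).
Qed.

Lemma nonneg_eigenfunction_gt0 Omega s pm pp lambda (g G : R -> R) u x1 :
  (0 < n)%N -> open Omega -> 0 < s < 1 -> young_function g G ->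
  (forall t, 0 < t -> pm <= t * g t / G t <= pp) ->
  n%:R / (s * (1 - s)) < pm ->
  WsG0 s G Omega u -> eigen_equation s g G Omega lambda u -> continuous u ->
  (forall x, 0 <= u x) -> Omega x1 -> 0 < u x1 ->
  forall x, Omega x -> 0 < u x.
Proof.
move=> n0 oO /andP[s0 s1] young hpm pmn Wu eigen cu u0 Ox1 ux1 x0 Ox0.
rewrite lt_neqAle u0 andbT; apply/negP => /eqP/esym ux0.
have l0 := eigenvalue_ge0 _ _ _ _ _ _ _ young oO Wu eigen cu u0 Ox1 ux1.
have mu_ : measurable_fun setT u by case: Wu => -[].
have n0' : 0 < n%:R :> R by rewrite ltr0n.
have s'0 : 0 < 1 - s by rewrite subr_gt0.
(* As [s < 1 <= n], the hypothesis gives [1 / (1 - s) <= n / (s (1 - s)) < pm]. The lower bound on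
   [p] makes the kernel exponent [(1 - s) * p - 1] positive. *)
have [p ps ppm] : exists2 p, (1 - s)^-1 < p & p < pm.
  have h : (1 - s)^-1 < pm.
    apply: le_lt_trans pmn; rewrite invfM mulrA ler_peMl ?invr_ge0 ?(ltW s'0)//.
    rewrite ler_pdivlMr// mul1r (le_trans (ltW s1))//.
    by rewrite -[1]/(1%:R) ler_nat.
  by exists (((1 - s)^-1 + pm) / 2); lra.
have p1 : 1 < p.
  by apply: lt_trans ps; rewrite invf_gt1// gtrBl.
have sp : 1 < (1 - s) * p by rewrite -ltr_pdivrMl// mulr1.
have p0 : 0 < p by exact: lt_trans p1.
have [C C0 hC] := young_density_power_bound _ _ _ _ _ _ young p0 ppm hpm.
have del0 : 0 < (1 - s) * p - 1 by rewrite subr_gt0.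
have [J J0 hJ] := @integral_dist_kernel R n _ _ del0 s0.
have [rO rO0 BO] := open_sup_box _ _ oO Ox0.
(* [r <= 1] keeps the tent below 1, and [n * r <= rO] keeps its support box inside [Omega]. *)
pose r := Num.min 1 (rO / n%:R).
have r0 : 0 < r by rewrite lt_min ltr01 divr_gt0.
have r1 : r <= 1 by rewrite ge_min lexx.
have BO' : sup_box x0 (n%:R * r) `<=` Omega.
  apply: subset_trans BO; apply: sup_boxS.
  by rewrite mulrC -ler_pdivlMr// ge_min lexx orbT.
pose c := u x1 / 2; have c0 : 0 < c by rewrite divr_gt0.
have cu1 : c < u x1 by rewrite /c; lra.
have [rK rK0 uK] := continuous_ge_sup_box _ _ _ cu cu1.
(* By the triangle inequality [M] bounds every coordinate of the difference between a point of the
   support box and a point of the box around [x1]; [D] then bounds the Euclidean distance. *)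
pose M := n%:R * r + euclidean_norm (x0 - x1) + rK.
have M0 : 0 < M.
  by rewrite ltr_wpDl// addr_ge0 ?euclidean_norm_ge0// mulr_ge0// ltW.
pose D := n%:R * M; have D0 : 0 < D by rewrite mulr_gt0.
(* The gap is [c / 2]: [u > c] on the box around [x1], while [u <= eps * phi <= c / 2] where
   [v > 0]. *)
pose kap := g (c / 2 / D `^ s) / D `^ s / D ^+ n.
have kap0 : 0 < kap.
  rewrite !divr_gt0 ?exprn_gt0 ?powR_gt0//.
  have [_ _ [_ gp] _ _] := young; apply: gp.
  by rewrite !divr_gt0 ?powR_gt0.
pose mK : R := (2 * rK) ^+ n.
have mK0 : 0 < mK by rewrite exprn_gt0// mulr_gt0.
(* Chosen so that [C * t * J < kap * mK]; the added 1 makes this strict and covers [J = 0]. *)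
pose t := kap * mK / (C * J + 1).
have CJ0 : 0 < C * J + 1 by rewrite ltr_wpDl// mulr_ge0// ltW.
have t0 : 0 < t by rewrite divr_gt0// mulr_gt0.
(* The three bounds keep the truncation below 1, make it vanish on the box around [x1], and give
   [eps^(p - 1) <= t]. *)
pose eps := Num.min (Num.min 1 (c / 2)) (t `^ (p - 1)^-1).
have e0 : 0 < eps by rewrite !lt_min ltr01 powR_gt0// divr_gt0.
have e1 : eps <= 1 by rewrite !ge_min lexx.
have ec : eps <= c / 2 by rewrite !ge_min lexx !orbT.
have p'0 : 0 < p - 1 by rewrite subr_gt0.
have et : eps `^ (p - 1) <= t.
  apply: (@le_trans _ _ ((t `^ (p - 1)^-1) `^ (p - 1))).
    by rewrite ge0_ler_powR ?nnegrE ?(ltW e0) ?powR_ge0 ?(ltW p'0)// ge_min lexx orbT.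
  by rewrite -powRrM mulVf ?gt_eqF// powRr1// ltW.
pose v := truncation u x0 r eps.
have v0 : forall x, 0 <= v x by exact: truncation_ge0.
have mv : measurable_fun setT v by exact: measurable_truncation.
have Wv : WsG0 s G Omega v by exact: (@WsG0_truncation _ _ _ p C g).
pose V := (\int[mu]_x (v x)%:E)%E.
have Vfin : (V < +oo)%E.
  apply: (@le_lt_trans _ _ (\int[mu]_x (\1_(sup_box x0 (n%:R * r)) x)%:E)%E).
    apply: ge0_le_integral => //.
    - by move=> x _; rewrite lee_fin.
    - exact/measurable_EFinP.
    - by apply/measurable_EFinP; apply: measurable_indic; exact: measurable_sup_box.
    - by move=> x _; rewrite lee_fin; exact: truncation_le_indic.
  by rewrite integral_indic_sup_box ?ltry// mulr_ge0// ltW.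
(* This is where [u x0 = 0] enters: near [x0] one has [u < eps * r / 4] and [phi >= r / 2], so
   [v >= eps * r / 8]. *)
have V0 : (0 < V)%E.
  have [r2 r20 hr2] : exists2 r2, 0 < r2 & forall y, sup_box x0 r2 y -> - (eps * r / 4) < - u y.
    apply: (@continuous_ge_sup_box _ _ (fun x => - u x)).
      by move=> x; apply: continuousN; exact: cu.
    by rewrite ux0 ltrN2 divr_gt0// mulr_gt0.
  apply: (@integral_gt0_box _ _ _ _ x0 (Num.min r2 (r / 2)) (eps * r / 8)) => //.
  - by rewrite lt_min r20 divr_gt0.
  - by rewrite divr_gt0// mulr_gt0.
  move=> y /sup_boxS yB; have /hr2 uy : sup_box x0 r2 y.
    by apply: yB; rewrite ge_min lexx.
  have /(tent_ge_half n0) ty : sup_box x0 (r / 2) y.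
    by apply: yB; rewrite ge_min lexx orbT.
  rewrite /v /truncation ler_pdivlMr// le_max; apply/orP; right.
  have : eps * (r / 2) <= eps * tent x0 r y by rewrite ler_wpM2l ?(ltW e0).
  by move: uy; clear; lra.
pose I z := signed_density g (Dquot s u z) * Dquot s v z / dist z ^+ n.
have mI : measurable_fun setT I.
  apply: measurable_div_dist; apply: measurable_funM; last exact: measurable_Dquot.
  exact: (measurableT_comp (measurable_signed_density young) (measurable_Dquot _ _ mu_)).
have mIE : measurable_fun setT (EFin \o I) by exact/measurable_EFinP.
have I0 : (0 <= \int[mu \x mu]_z (EFin \o I) z)%E.
  have -> : (\int[mu \x mu]_z (EFin \o I) z = lambda%:E *
      \int[mu]_(x in Omega) (signed_density g (u x) * v x)%:E)%E by exact: eigen.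
  rewrite mule_ge0 ?lee_fin// integral_ge0// => x _.
  by rewrite lee_fin mulr_ge0// (signed_density_ge0 young).
pose K : 'rV[R]_n * 'rV[R]_n -> R := dist_kernel ((1 - s) * p - 1) s.
have mP : measurable_fun setT (fun z => K z * (v z.1 + v z.2)).
  apply: measurable_funM; first exact: measurable_dist_kernel.
  by apply: measurable_funD; exact: (measurableT_comp mv).
have P0 z : 0 <= K z * (v z.1 + v z.2).
  by rewrite mulr_ge0 ?dist_kernel_ge0// addr_ge0.
have Ce0 : 0 <= C * eps `^ (p - 1) by rewrite mulr_ge0 ?powR_ge0// ltW.
have Ipos : (\int[mu \x mu]_z (EFin \o I)^\+ z <= (C * eps `^ (p - 1) * J)%:E * V)%E.
  apply: (@le_trans _ _ (\int[mu \x mu]_z ((C * eps `^ (p - 1))%:E *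
      (K z * (v z.1 + v z.2))%:E))%E).
    apply: ge0_le_integral => //.
    - exact: measurable_funepos.
    - by apply/measurable_EFinP; exact: measurable_funM.
    - move=> z _; rewrite funeposE /= -EFin_max lee_fin ge_max mulr_ge0// andbT.
      exact: (@form_truncation_le _ _ s p C g G).
  rewrite ge0_integralZl//; last 2 first.
  - exact/measurable_EFinP.
  - by move=> z _; rewrite lee_fin.
  by rewrite (EFinM _ J) -muleA lee_wpmul2l ?lee_fin// hJ.
have mBK : measurable_fun setT (\1_(sup_box x1 rK) : _ -> R).
  by apply: measurable_indic; exact: measurable_sup_box.
have mN : measurable_fun setT (fun z : 'rV[R]_n * 'rV[R]_n =>
    kap * v z.1 * \1_(sup_box x1 rK) z.2).
  apply: measurable_funM; last exact: (measurableT_comp mBK).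
  by apply: measurable_funM => //; exact: (measurableT_comp mv).
(* Only pairs whose second point lies in the box around [x1], of volume [mK], are retained; Tonelli
   then separates the variables. *)
have Ineg : ((kap * mK)%:E * V <= \int[mu \x mu]_z (EFin \o I)^\- z)%E.
  apply: (@le_trans _ _ (\int[mu \x mu]_z
      (kap * v z.1 * \1_(sup_box x1 rK) z.2)%:E)%E).
    rewrite fubini_tonelli1//; last 2 first.
    - exact/measurable_EFinP.
    - by move=> z; rewrite lee_fin mulr_ge0// mulr_ge0// ltW.
    rewrite -ge0_integralZl//; last 3 first.
    - exact/measurable_EFinP.
    - by move=> x _; rewrite lee_fin.
    - by rewrite lee_fin mulr_ge0// ltW.
    rewrite le_eqVlt; apply/orP; left; apply/eqP.
    apply: eq_integral => x _; rewrite /fubini_F/=.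
    under eq_integral do rewrite EFinM.
    rewrite ge0_integralZl//; last 2 first.
    - exact/measurable_EFinP.
    - by rewrite lee_fin mulr_ge0// ltW.
    rewrite integral_indic_sup_box ?(ltW rK0)// -!EFinM; congr EFin.
    by rewrite /mK; ring.
  apply: ge0_le_integral => //.
  - by move=> z _; rewrite lee_fin mulr_ge0// mulr_ge0// ltW.
  - exact/measurable_EFinP.
  - exact: measurable_funeneg.
  move=> z _; rewrite funenegE/= -EFin_max lee_fin le_max.
  rewrite indicE; have [|_] := boolP (z.2 \in sup_box x1 rK); last first.
    by rewrite mulr0 lexx orbT.
  rewrite inE mulr1 => zK; have := v0 z.1; rewrite le_eqVlt => /predU1P[<-|vz].
    by rewrite mulr0 lexx orbT.
  apply/orP; left.
  have uz2 := uK _ zK.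
  have vphi (x : 'rV[R]_n) : eps * tent x0 r x <= c / 2.
    apply: le_trans ec; rewrite ler_piMr ?(ltW e0)//.
    by rewrite (le_trans (tent_le _ _ _ (ltW r0))).
  apply: (form_away_le _ _ _ _ _ _ _ _ young) => //; first by rewrite divr_gt0.
  - rewrite /v /truncation max_l ?mul0r//.
    by have := vphi z.2; move: uz2 c0; clear; lra.
  - have [uz1 _] := truncation_gt0 u x0 r eps n0 u0 e0 z.1 vz.
    rewrite uz1; have := vphi z.1; move: uz2 vz; rewrite -/v; clear; lra.
  - apply: euclidean_norm_le; first exact: ltW.
    move=> i; rewrite !mxE.
    have [_ zB] := truncation_gt0 u x0 r eps n0 u0 e0 z.1 vz.
    have x01 := le_coord_euclidean_norm (x0 - x1) i; rewrite !mxE in x01.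
    have zBi : `|x0 ord0 i - z.1 ord0 i| <= n%:R * r := zB i.
    have zKi : `|x1 ord0 i - z.2 ord0 i| <= rK := zK i.
    have -> : z.1 ord0 i - z.2 ord0 i = - (x0 ord0 i - z.1 ord0 i) +
      (x0 ord0 i - x1 ord0 i) + (x1 ord0 i - z.2 ord0 i) by ring.
    rewrite (le_trans (ler_normD _ _))// lerD// (le_trans (ler_normD _ _))//.
    by rewrite normrN lerD.
have Vn : V \is a fin_num by rewrite ge0_fin_numE// ltW.
have posfin : (\int[mu \x mu]_z (EFin \o I)^\+ z \is a fin_num)%E.
  rewrite ge0_fin_numE ?integral_ge0//; apply: le_lt_trans Ipos _.
  by rewrite lte_mul_pinfty// lee_fin mulr_ge0.
(* The positive part has finite integral, so [I0] says that the negative part integrates to no more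
   than it. Since [V] is finite and positive it cancels, leaving
   [kap * mK <= C * eps^(p - 1) * J]. *)
move: I0; rewrite integralE sube_ge0 ?posfin ?orbT//.
move=> /(le_trans Ineg)/le_trans/(_ Ipos).
rewrite lee_pmul2r// lee_fin leNgt => /negP; apply.
apply: (@le_lt_trans _ _ (C * t * J)).
  by rewrite ler_wpM2r// ler_wpM2l// ltW.
rewrite mulrAC /t mulrA ltr_pdivrMr// mulrC (ltr_pM2l (mulr_gt0 kap0 mK0)).
by rewrite ltrDl.
Qed.

End Positivity.

Theorem theorem4p4 (R : realType) (n : nat) (Omega : set 'rV[R]_n)
    (s pm pp mu lambda : R) (g G : R -> R) (u : 'rV[R]_n -> R) :
  (0 < n)%N ->
  open Omega -> bounded_set Omega ->
  0 < s < 1 ->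
  young_function g G ->
  1 < pm ->
  (forall t, 0 < t -> pm <= t * g t / G t <= pp) ->
  n%:R / (s * (1 - s)) < pm ->
  0 < mu ->
  is_minimizer s G Omega mu u ->
  eigen_equation s g G Omega lambda u ->
  continuous u ->
  (forall x, Omega x -> 0 < u x) \/ (forall x, Omega x -> u x < 0).
Proof.
move=> n0 oO _ s01 young _ hpm pmn mu0 min_u eigen cu.
have [Mu _] := min_u; have [Wu Gmu] := Mu.
(* Otherwise the constraint integral would be 0 instead of [mu > 0]. *)
have [x1 Ox1 ux1] : exists2 x, Omega x & u x != 0.
  apply: contrapT => h; move: Gmu; rewrite /calG integral0_eq.
    by move=> -[] /eqP; rewrite lt_eqF.
  move=> x Ox; have [->|ux] := eqVneq (u x) 0.
    by rewrite normr0 (young0 young).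
  by case: h; exists x.
have [u0|u0] := minimizer_sign _ _ _ young _ _ _ mu0 min_u cu.
  left; apply: (@nonneg_eigenfunction_gt0 _ _ _ s pm pp lambda g G u x1) => //.
  by rewrite lt_neqAle eq_sym ux1 u0.
(* For [u <= 0], the function [- u] is a nonnegative solution with the same [lambda]. *)
right=> x Ox; rewrite -oppr_gt0; move: x Ox.
apply: (@nonneg_eigenfunction_gt0 _ _ _ s pm pp lambda g G (fun x => - u x) x1) => //.
- exact: WsG0_opp.
- exact: eigen_equation_opp.
- by move=> x; apply: continuousN; exact: cu.
- by move=> x; rewrite oppr_ge0.
- by rewrite lt_neqAle eq_sym oppr_eq0 ux1 oppr_ge0 u0.
Qed.
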